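(* Let $S$ be the species of split graphs, $U$ the species of unbalanced split graphs, $E$ the species of sets, and $X$ the species of singletons. Then, in the ring of virtual species, $$U = \frac{(2-X)\cdot E - 2}{(1-X)\cdot E}\cdot S.$$
   Context: Graphs are finite and simple (the graph with no vertices is allowed). A split graph is a graph whose vertices can be partitioned into two (possibly empty) sets $K$ and $S$ such that $K$ is a clique and $S$ is a stable (independent) set; such an ordered partition $(K,S)$ is called a $KS$-partition. A split graph is balanced if it has a unique $KS$-partition, and unbalanced otherwise. A (combinatorial) species $F$ is a functor from the category of finite sets with bijections to itself: it assigns to each finite set $I$ a finite set $F[I]$ of structures with label set $I$, and to each bijection $\varphi\colon I\to J$ a bijection $F[\varphi]\colon F[I]\to F[J]$, functorially. Isomorphic species (naturally equivalent functors) are regarded as equal. For a species of graphs with a certain isomorphism-invariant property, $F[I]$ is the set of such graphs with vertex set $I$, and $F[\varphi]$ replaces each label $i$ by $\varphi(i)$. The species of split graphs and of unbalanced split graphs are defined this way. Sum: $(F+G)[I]=F[I]\sqcup G[I]$. Product: $(F\cdot G)[I]$ is the set of pairs $(f,g)$ with $f\in F[V]$, $g\in G[W]$, over all ordered partitions $I=V\sqcup W$ (parts may be empty). The species $0$ has no structures; the species $1$ has exactly one structure on the empty set and none on nonempty sets; an integer $m\ge 0$ denotes $1+\cdots+1$ ($m$ times). $E$ is the species of sets: $E[I]=\{I\}$ for all finite $I$. $X$ is the species of singletons: $X[I]=\{I\}$ if $|I|=1$ and $X[I]=\varnothing$ otherwise. The ring of virtual species consists of formal differences $F^+-F^-$ of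 species, where $F^+-F^-$ and $G^+-G^-$ are identified when the species $F^++G^-$ and $G^++F^-$ are isomorphic; addition and multiplication extend those of species, with $0$ and $1$ as identities. A virtual species whose part of size $0$ is $1$ or $-1$ is a unit of this ring; for a unit $F$, $1/F$ denotes its multiplicative inverse, and fractions are written accordingly. (In particular $(1-X)\cdot E$ is a unit.) *)

(* Defs.v *)
From mathcomp Require Import all_boot.
From Stdlib Require Import ClassicalEpsilon.

Set Implicit Arguments.
Unset Strict Implicit.
Unset Printing Implicit Defensive.

Record iso (I J : Type) := Iso {
  fwd :> I -> J;
  bwd : J -> I;
  fwdK : cancel fwd bwd;
  bwdK : cancel bwd fwd }.

Definition iso_id (I : Type) : iso I I := @Iso I I id id (frefl _) (frefl _).

Definition iso_comp (I J K : Type) (t : iso J K) (s : iso I J) : iso I K :=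
  Iso (can_comp (fwdK t) (fwdK s)) (can_comp (bwdK s) (bwdK t)).

Definition part (I : finType) (A : {set I}) : finType := {x : I | x \in A}.

Section Restriction.
Variables (I J : finType) (s : iso I J) (A : {set I}) (B : {set J}).
Hypothesis AB : forall x, (s x \in B) = (x \in A).

Lemma res_fwd_subproof (u : part A) : s (val u) \in B.
Proof. by rewrite AB; exact: valP. Qed.

Lemma res_bwd_subproof (v : part B) : bwd s (val v) \in A.
Proof. by rewrite -AB bwdK; exact: valP. Qed.

Definition res_fwd (u : part A) : part B := exist (fun y => y \in B) _ (res_fwd_subproof u).
Definition res_bwd (v : part B) : part A := exist (fun x => x \in A) _ (res_bwd_subproof v).

Lemma res_fwdK : cancel res_fwd res_bwd.
Proof. by move=> u; apply: val_inj => /=; rewrite fwdK. Qed.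

Lemma res_bwdK : cancel res_bwd res_fwd.
Proof. by move=> v; apply: val_inj => /=; rewrite bwdK. Qed.

Definition iso_res : iso (part A) (part B) := Iso res_fwdK res_bwdK.
End Restriction.

Lemma iso_card (I J : finType) (s : iso I J) : #|I| = #|J|.
Proof. exact: bij_eq_card (Bijective (fwdK s) (bwdK s)). Qed.

(* [transport_ext]: a bijection is determined by its forward map, so transport
   may depend on nothing else.  That transports are bijections follows from
   functoriality. *)
Record species := Species {
  str :> finType -> finType;
  transport : forall I J : finType, iso I J -> str I -> str J;
  transport_ext : forall (I J : finType) (s t : iso I J),
    s =1 t -> transport s =1 transport t;
  transport_id : forall I : finType, transport (iso_id I) =1 id;
  transport_comp : forall (I J K : finType) (t : iso J K) (s : iso I J),
    transport (iso_comp t s) =1 transport t \o transport s }.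

Definition species_iso (F G : species) : Prop :=
  exists phi : forall I : finType, iso (F I) (G I),
    forall (I J : finType) (s : iso I J) (x : F I),
      phi J (transport s x) = transport s (phi I x).

(* A one-point set stands for the set [{I}] of structures on [I], which gives an
   isomorphic species. *)
Section CardSpecies.
Variable P : pred nat.

Definition card_str (I : finType) : finType := {_ : unit | P #|I|}.

Definition card_transport (I J : finType) (s : iso I J) (u : card_str I) :
    card_str J :=
  exist (fun=> P #|J|) tt (eq_ind #|I| (fun n => P n) (proj2_sig u) #|J| (iso_card s)).

Lemma card_str_eq (I : finType) (u v : card_str I) : u = v.
Proof. by apply: val_inj; case: (val u); case: (val v). Qed.

Definition card_species : species.
Proof.
by exists card_str card_transport; repeat move=> ?; apply: card_str_eq.
Defined.
End CardSpecies.

Definition sp_one : species := card_species (pred1 0).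
Definition sp_X : species := card_species (pred1 1).
Definition sp_E : species := card_species predT.

Definition sp_zero : species.
Proof. by exists (fun=> void : finType) (fun _ _ _ => id). Defined.

Section Sum.
Variables F G : species.

Definition sum_str (I : finType) : finType := (F I + G I)%type.

Definition sum_transport (I J : finType) (s : iso I J) (x : sum_str I) :
    sum_str J :=
  match x with
  | inl f => inl (transport s f)
  | inr g => inr (transport s g)
  end.

Definition sp_add : species.
Proof.
exists sum_str sum_transport.
- by move=> I J s t st [f|g] /=; rewrite (transport_ext st).
- by move=> I [f|g] /=; rewrite transport_id.
- by move=> I J K t s [f|g] /=; rewrite transport_comp.
Defined.
End Sum.

Section Product.
Variables F G : species.

(* An ordered partition of [I] into two parts is a pair [(V, ~: V)]. *)
Definition prod_str (I : finType) : finType :=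
  {V : {set I} & (F (part V) * G (part (~: V)))%type}.

Lemma image_in (I J : finType) (s : iso I J) (V : {set I}) x :
  (s x \in s @: V) = (x \in V).
Proof. exact: mem_imset (can_inj (fwdK s)). Qed.

Lemma imageC_in (I J : finType) (s : iso I J) (V : {set I}) x :
  (s x \in ~: (s @: V)) = (x \in ~: V).
Proof. by rewrite !inE image_in. Qed.

Definition prod_transport (I J : finType) (s : iso I J) (x : prod_str I) :
    prod_str J :=
  let: existT V (f, g) := x in
  existT _ (s @: V) (transport (iso_res (@image_in _ _ s V)) f,
                     transport (iso_res (@imageC_in _ _ s V)) g).

Lemma prod_str_eq (I : finType) (V W : {set I})
    (s : iso (part V) (part W)) (t : iso (part (~: V)) (part (~: W)))
    (f : F (part V)) (g : G (part (~: V))) :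
  V = W -> (forall u, val (s u) = val u) -> (forall u, val (t u) = val u) ->
  existT (fun A : {set I} => (F (part A) * G (part (~: A)))%type) V (f, g) =
  existT _ W (transport s f, transport t g).
Proof.
move=> VW; case: W / VW s t => s t s1 t1.
have s_id : s =1 iso_id _ by move=> u; apply: val_inj; rewrite s1.
have t_id : t =1 iso_id _ by move=> u; apply: val_inj; rewrite t1.
by rewrite (transport_ext s_id) (transport_ext t_id) !transport_id.
Qed.

Lemma prod_str_congr (I : finType) (V : {set I})
    (f f' : F (part V)) (g g' : G (part (~: V))) :
  f = f' -> g = g' ->
  existT (fun A : {set I} => (F (part A) * G (part (~: A)))%type) V (f, g) =
  existT _ V (f', g').
Proof. by move=> -> ->. Qed.

Definition sp_mul : species.
Proof.
exists prod_str prod_transport.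
- move=> I J s t st [V [f g]] /=.
  have e : s @: V = t @: V by apply: eq_imset.
  have a u : (iso_id J u \in t @: V) = (u \in s @: V) by rewrite e.
  have b u : (iso_id J u \in ~: (t @: V)) = (u \in ~: (s @: V)) by rewrite e.
  rewrite (prod_str_eq (s := iso_res a) (t := iso_res b) _ _ e) //.
  apply: prod_str_congr.
  + rewrite -[LHS]/((transport _ \o transport _) f) -transport_comp.
    by apply: transport_ext => u; apply: val_inj; exact: st.
  + rewrite -[LHS]/((transport _ \o transport _) g) -transport_comp.
    by apply: transport_ext => u; apply: val_inj; exact: st.
- move=> I [V [f g]] /=; apply/esym/prod_str_eq => //.
  by rewrite imset_id.
- move=> I J K t s [V [f g]] /=.
  have e : iso_comp t s @: V = t @: (s @: V) by rewrite -imset_comp.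
  have a u : (iso_id K u \in t @: (s @: V)) = (u \in iso_comp t s @: V).
    by rewrite e.
  have b u : (iso_id K u \in ~: (t @: (s @: V))) =
             (u \in ~: (iso_comp t s @: V)) by rewrite e.
  rewrite (prod_str_eq (s := iso_res a) (t := iso_res b) _ _ e) //.
  apply: prod_str_congr.
  + rewrite -[LHS]/((transport _ \o transport _) f).
    rewrite -[RHS]/((transport _ \o transport _) f) -!transport_comp.
    by apply: transport_ext => u; apply: val_inj.
  + rewrite -[LHS]/((transport _ \o transport _) g).
    rewrite -[RHS]/((transport _ \o transport _) g) -!transport_comp.
    by apply: transport_ext => u; apply: val_inj.
Defined.
End Product.

Definition sp_nat (m : nat) : species := iter m (sp_add sp_one) sp_zero.

Definition edge_rel (I : finType) : finType := {ffun I * I -> bool}.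

Definition simple_graph (I : finType) (e : edge_rel I) : bool :=
  [forall x, ~~ e (x, x)] && [forall x, forall y, e (x, y) == e (y, x)].

Definition clique (I : finType) (e : edge_rel I) (K : {set I}) : bool :=
  [forall x in K, forall y in K, (x != y) ==> e (x, y)].

Definition stable (I : finType) (e : edge_rel I) (S : {set I}) : bool :=
  [forall x in S, forall y in S, ~~ e (x, y)].

Definition KS_partition (I : finType) (e : edge_rel I)
    (KS : {set I} * {set I}) : bool :=
  [&& KS.1 :|: KS.2 == setT, [disjoint KS.1 & KS.2],
      clique e KS.1 & stable e KS.2].

Definition split_graph (I : finType) (e : edge_rel I) : bool :=
  simple_graph e && [exists KS, KS_partition e KS].

Definition balanced (I : finType) (e : edge_rel I) : bool :=
  split_graph e && (#|[set KS | KS_partition e KS]| == 1).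

Definition unbalanced (I : finType) (e : edge_rel I) : bool :=
  split_graph e && ~~ balanced e.

Definition relabel (I J : finType) (s : iso I J) (e : edge_rel I) :
    edge_rel J :=
  [ffun p => e (bwd s p.1, bwd s p.2)].

Section GraphSpecies.
Variable P : forall I : finType, pred (edge_rel I).
Hypothesis P_relabel : forall (I J : finType) (s : iso I J) (e : edge_rel I),
  P (relabel s e) = P e.

Definition graph_str (I : finType) : finType := {e : edge_rel I | P e}.

Lemma graph_transport_subproof (I J : finType) (s : iso I J)
  (u : graph_str I) : P (relabel s (val u)).
Proof. by rewrite P_relabel; exact: valP. Qed.

Definition graph_transport (I J : finType) (s : iso I J) (u : graph_str I) :
    graph_str J := exist (@P J) _ (graph_transport_subproof s u).

Definition graph_species : species.
Proof.
exists graph_str graph_transport.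
- move=> I J s t st u; apply: val_inj; apply/ffunP=> p; rewrite !ffunE.
  have st' y : bwd s y = bwd t y.
    by rewrite -[LHS](fwdK t) -st bwdK.
  by rewrite !st'.
- by move=> I u; apply: val_inj; apply/ffunP=> -[x y]; rewrite !ffunE.
- by move=> I J K t s u; apply: val_inj; apply/ffunP=> p; rewrite !ffunE.
Defined.
End GraphSpecies.

Section Invariance.
Variables (I J : finType) (s : iso I J) (e : edge_rel I).

Lemma forall_relabel (p : pred J) : [forall y, p y] = [forall x, p (s x)].
Proof.
apply/forallP/forallP=> [h x|h y]; first exact: h.
by rewrite -(bwdK s y).
Qed.

Lemma relabelE x y : relabel s e (s x, s y) = e (x, y).
Proof. by rewrite ffunE /= !fwdK. Qed.

Lemma simple_graph_relabel : simple_graph (relabel s e) = simple_graph e.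
Proof.
rewrite /simple_graph !forall_relabel; congr (_ && _); apply: eq_forallb => x.
  by rewrite relabelE.
by rewrite forall_relabel; apply: eq_forallb => y; rewrite !relabelE.
Qed.

Definition image_pair (KS : {set I} * {set I}) : {set J} * {set J} :=
  (s @: KS.1, s @: KS.2).

Lemma image_pair_bij : bijective image_pair.
Proof.
have can_im (A B : finType) (f : A -> B) (g : B -> A) (X : {set A}) :
  cancel f g -> g @: (f @: X) = X.
  by move=> fK; rewrite -imset_comp (eq_imset _ fK) imset_id.
exists (fun KS : {set J} * {set J} => (bwd s @: KS.1, bwd s @: KS.2)).
  by move=> [K S]; rewrite /image_pair /= !can_im //; exact: fwdK.
by move=> [K S]; rewrite /image_pair /= !can_im //; exact: bwdK.
Qed.

Lemma clique_relabel (K : {set I}) : clique (relabel s e) (s @: K) = clique e K.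
Proof.
rewrite /clique forall_relabel; apply: eq_forallb => x; rewrite image_in.
congr (_ ==> _); rewrite forall_relabel; apply: eq_forallb => y.
by rewrite image_in relabelE (inj_eq (can_inj (fwdK s))).
Qed.

Lemma stable_relabel (S : {set I}) : stable (relabel s e) (s @: S) = stable e S.
Proof.
rewrite /stable forall_relabel; apply: eq_forallb => x; rewrite image_in.
congr (_ ==> _); rewrite forall_relabel; apply: eq_forallb => y.
by rewrite image_in relabelE.
Qed.

Lemma KS_partition_relabel (KS : {set I} * {set I}) :
  KS_partition (relabel s e) (image_pair KS) = KS_partition e KS.
Proof.
case: KS => K S; rewrite /KS_partition /= clique_relabel stable_relabel.
rewrite (imset_disjoint (can_inj (fwdK s))).
congr (_ && _); rewrite -imsetU -!subTset.
apply/subsetP/subsetP=> h x _; last by rewrite -(bwdK s x) image_in h.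
by rewrite -(image_in s) h.
Qed.

Lemma split_graph_relabel : split_graph (relabel s e) = split_graph e.
Proof.
rewrite /split_graph simple_graph_relabel; congr (_ && _).
have [g fK gK] := image_pair_bij.
apply/existsP/existsP=> [[KS h]|[KS h]].
  by exists (g KS); rewrite -KS_partition_relabel gK.
by exists (image_pair KS); rewrite KS_partition_relabel.
Qed.

Lemma unbalanced_relabel : unbalanced (relabel s e) = unbalanced e.
Proof.
rewrite /unbalanced /balanced split_graph_relabel.
suff -> : [set KS | KS_partition (relabel s e) KS] =
          image_pair @: [set KS | KS_partition e KS].
  by rewrite card_imset //; apply: bij_inj image_pair_bij.
have [g fK gK] := image_pair_bij.
apply/setP=> KS; rewrite -[KS]gK (mem_imset _ _ (can_inj fK)) !inE.
exact: KS_partition_relabel.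
Qed.
End Invariance.

Definition sp_split : species := graph_species split_graph_relabel.
Definition sp_unbalanced : species := graph_species unbalanced_relabel.

(* Elements of the ring of virtual species are represented by formal
   differences, equality in that ring being [veq]. *)
Record vspecies := VSpecies { vpos : species; vneg : species }.

Definition virt (F : species) : vspecies := VSpecies F sp_zero.

Definition veq (F G : vspecies) : Prop :=
  species_iso (sp_add (vpos F) (vneg G)) (sp_add (vpos G) (vneg F)).

Definition vadd (F G : vspecies) : vspecies :=
  VSpecies (sp_add (vpos F) (vpos G)) (sp_add (vneg F) (vneg G)).

Definition vopp (F : vspecies) : vspecies := VSpecies (vneg F) (vpos F).

Definition vsub (F G : vspecies) : vspecies := vadd F (vopp G).

Definition vmul (F G : vspecies) : vspecies :=
  VSpecies
    (sp_add (sp_mul (vpos F) (vpos G)) (sp_mul (vneg F) (vneg G)))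
    (sp_add (sp_mul (vpos F) (vneg G)) (sp_mul (vneg F) (vpos G))).

Definition vnat (m : nat) : vspecies := virt (sp_nat m).

(* A representative of the multiplicative inverse of [F] when [F] is a unit
   (the inverse is unique up to [veq]); an unspecified value otherwise. *)
Definition vinv (F : vspecies) : vspecies :=
  epsilon (inhabits (vnat 0)) (fun G => veq (vmul F G) (virt sp_one)).

Definition vdiv (F G : vspecies) : vspecies := vmul F (vinv G).

Declare Scope vspecies_scope.
Delimit Scope vspecies_scope with V.
Bind Scope vspecies_scope with vspecies.
Notation "F ≡ G" := (veq F G) (at level 70, no associativity) : vspecies_scope.
Notation "F + G" := (vadd F G) : vspecies_scope.
Notation "F - G" := (vsub F G) : vspecies_scope.
Notation "F * G" := (vmul F G) : vspecies_scope.
Notation "F / G" := (vdiv F G) : vspecies_scope.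

(* Main.v *)
Require Import Defs.
From mathcomp Require Import all_boot zify.
From Stdlib Require Import ClassicalEpsilon Setoid Morphisms Ring.

(* Let C be the species of split graphs with a chosen clique side K, and Z the
   subspecies where no vertex of K can be moved to the stable side. A movable
   vertex of K has no neighbour outside K, so removing all movable vertices of K
   gives C = E Z, and marking one of them gives X C. For a fixed split graph, the
   clique sides, joined by an edge when they differ by one vertex, form a star;
   choosing its centre canonically and sending every edge to its non-central end
   gives C = S + X C. A clique side is unique exactly when it can neither shrink
   nor grow, it cannot do both, and complementation exchanges the two; with M
   the clique sides that can shrink, C = (S - U) + 2 M and C = M + Z. Hence
   S = (1 - X) E Z and U = ((2 - X) E - 2) Z. *)

Set Implicit Arguments.
Unset Strict Implicit.
Unset Printing Implicit Defensive.

(** Every correspondence must commute with relabelling, so nothing may be picked arbitrarily: this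
    is why stars need a canonical centre and why cancellation needs an explicit walk. Cancellation,
    from [F + H = G + H] to [F = G], comes before any computation with formal differences, since
    their equality is not transitive without it.

    Clique sides form a star because each of two sides has at most one vertex outside the other.
    Nested distinct sides thus differ in size by exactly one, and no three distinct sides are
    pairwise nested. Two sides that are not nested force their union or their intersection to be a
    side, and that side is nested with all sides: it is the centre. A star with a single edge has
    two candidates for its centre, hence a tie-break. *)

Section IsoOf.
Variables (A B : finType) (f : A -> B).
Hypotheses (f_inj : injective f) (f_onto : forall y, exists x, f x == y).

Lemma iso_of_fwdK : cancel f (fun y => xchoose (f_onto y)).
Proof. by move=> x; apply: f_inj; apply/eqP/(xchooseP (f_onto (f x))). Qed.

Lemma iso_of_bwdK : cancel (fun y => xchoose (f_onto y)) f.
Proof. by move=> y; apply/eqP/(xchooseP (f_onto y)). Qed.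

(** The inverse is data in [iso], so surjectivity is assumed with boolean equality, from which
    [xchoose] extracts a preimage. *)
Definition iso_of : iso A B := Iso iso_of_fwdK iso_of_bwdK.
End IsoOf.

Definition iso_inv (I J : Type) (s : iso I J) : iso J I := Iso (bwdK s) (fwdK s).

Lemma iso_inj (I J : Type) (s : iso I J) (x y : I) : s x = s y -> x = y.
Proof. exact: can_inj (fwdK s) x y. Qed.

Lemma transport_compE (F : species) (I J K : finType) (t : iso J K)
    (s : iso I J) (x : F I) :
  transport t (transport s x) = transport (iso_comp t s) x.
Proof. by rewrite transport_comp. Qed.

Lemma transport_eq_id (F : species) (I : finType) (s : iso I I) (x : F I) :
  s =1 id -> transport s x = x.
Proof.
by move=> s_id; rewrite (transport_ext (t := iso_id I)) // transport_id.
Qed.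

Lemma transport1 (F : species) (I : finType) (x : F I) :
  transport (iso_id I) x = x.
Proof. exact: transport_id. Qed.

Lemma transport_invK (F : species) (I J : finType) (s : iso I J) (x : F I) :
  transport (iso_inv s) (transport s x) = x.
Proof. by rewrite transport_compE transport_eq_id // => u /=; rewrite fwdK. Qed.

Lemma transportKinv (F : species) (I J : finType) (s : iso I J) (x : F J) :
  transport s (transport (iso_inv s) x) = x.
Proof. by rewrite transport_compE transport_eq_id // => u /=; rewrite bwdK. Qed.

(** * Natural maps and isomorphisms of species *)

Definition natural (F G : species) (phi : forall I : finType, F I -> G I) :=
  forall (I J : finType) (s : iso I J) (x : F I),
    phi J (transport s x) = transport s (phi I x).

Lemma natural_bij_iso (F G : species) (phi : forall I : finType, F I -> G I) :
  natural phi -> (forall I, injective (phi I)) ->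
  (forall I y, exists x, phi I x = y) -> species_iso F G.
Proof.
move=> nat_phi inj_phi onto_phi.
have onto I y : exists x, phi I x == y by have [x <-] := onto_phi I y; exists x.
by exists (fun I => iso_of (@inj_phi I) (onto I)) => I J s x /=; rewrite nat_phi.
Qed.

(** Working with surjections avoids injectivity proofs on products, where equalities between
    dependent pairs would have to be inverted. *)
Definition natural_surjection (F G : species) : Prop :=
  exists2 phi : forall I : finType, F I -> G I,
    natural phi & forall I y, exists x, phi I x = y.

Lemma onto_card (A B : finType) (f : A -> B) :
  (forall y, exists x, f x = y) -> #|B| <= #|A|.
Proof.
move=> onto; rewrite -!cardsT -(_ : f @: setT = setT) ?leq_imset_card //.
apply/setP=> y; rewrite inE; have [x <-] := onto y.
by rewrite imset_f.
Qed.

(* Structure sets are finite, so surjections in both directions force each of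
   them to be bijective. *)
Lemma natural_surjections_iso (F G : species) :
  natural_surjection F G -> natural_surjection G F -> species_iso F G.
Proof.
case=> phi nat_phi onto_phi [psi _ onto_psi].
apply: (natural_bij_iso nat_phi) => // I; apply: in2T.
have /imset_injP : #|phi I @: setT| == #|[set: F I]|.
  rewrite eqn_leq leq_imset_card /= cardsT.
  apply: leq_trans (onto_card (onto_psi I)) _; rewrite -cardsT subset_leq_card //.
  by apply/subsetP=> y _; have [x <-] := onto_phi I y; rewrite imset_f.
by move=> inj x y _ _; apply: inj; rewrite inE.
Qed.

#[global] Instance species_iso_equiv : Equivalence species_iso.
Proof.
split.
- by move=> F; exists (fun I => iso_id _).
- move=> F G [phi nat_phi]; exists (fun I => iso_inv (phi I)) => I J s x /=.
  by apply: (iso_inj (s := phi J)); rewrite nat_phi !bwdK.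
- move=> F G H [phi nat_phi] [psi nat_psi].
  exists (fun I => iso_comp (psi I) (phi I)) => I J s x /=.
  by rewrite nat_phi nat_psi.
Qed.

Lemma species_iso_surjection (F G : species) :
  species_iso F G -> natural_surjection F G.
Proof.
case=> phi nat_phi; exists (fun I => phi I) => // I y.
by exists (bwd (phi I) y); rewrite bwdK.
Qed.

Lemma sp_add_surjection (F F' G G' : species) :
  natural_surjection F F' -> natural_surjection G G' ->
  natural_surjection (sp_add F G) (sp_add F' G').
Proof.
move=> [phi nphi ophi] [psi npsi opsi].
exists (fun I (x : sp_add F G I) => match x return sp_add F' G' I with
  inl f => inl (phi I f) | inr g => inr (psi I g) end).
- by move=> I J s [f|g] /=; rewrite ?nphi ?npsi.
- move=> I [f|g]; first by have [x <-] := ophi I f; exists (inl x).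
  by have [x <-] := opsi I g; exists (inr x).
Qed.

Lemma sp_mul_surjection (F F' G G' : species) :
  natural_surjection F F' -> natural_surjection G G' ->
  natural_surjection (sp_mul F G) (sp_mul F' G').
Proof.
move=> [phi nphi ophi] [psi npsi opsi].
exists (fun I (x : sp_mul F G I) => (let: existT V (f, g) := x in
  existT _ V (phi _ f, psi _ g)) : sp_mul F' G' I).
- by move=> I J s [V [f g]] /=; rewrite nphi npsi.
- move=> I [V [f g]]; have [x <-] := ophi _ f; have [y <-] := opsi _ g.
  by exists (existT _ V (x, y)).
Qed.

#[global] Instance sp_add_proper :
  Proper (species_iso ==> species_iso ==> species_iso) sp_add.
Proof.
move=> F F' FF' G G' GG'; apply: natural_surjections_iso;
  by apply: sp_add_surjection; apply: species_iso_surjection => //; symmetry.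
Qed.

#[global] Instance sp_mul_proper :
  Proper (species_iso ==> species_iso ==> species_iso) sp_mul.
Proof.
move=> F F' FF' G G' GG'; apply: natural_surjections_iso;
  by apply: sp_mul_surjection; apply: species_iso_surjection => //; symmetry.
Qed.

(** * Products and decompositions of the label set *)

Section Pair.
Variables (A B I : finType) (i : iso (A + B)%type I).

Definition left_image : {set I} := [set i (inl a) | a : A].

Lemma left_image_inl a : i (inl a) \in left_image.
Proof. exact: (imset_f (fun a => i (inl a))). Qed.

Lemma left_image_inr b : i (inr b) \in ~: left_image.
Proof. by rewrite inE; apply/imsetP=> -[a _ ab]; have := iso_inj ab. Qed.

Definition to_left (a : A) : part left_image :=
  exist (fun x => x \in left_image) _ (left_image_inl a).
Definition to_right (b : B) : part (~: left_image) :=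
  exist (fun x => x \in ~: left_image) _ (left_image_inr b).

Lemma to_left_inj : injective to_left.
Proof. by move=> a a' /(congr1 val) e; have [] := iso_inj e. Qed.

Lemma to_right_inj : injective to_right.
Proof. by move=> a a' /(congr1 val) e; have [] := iso_inj e. Qed.

Lemma to_left_onto y : exists a, to_left a == y.
Proof.
case: y => x x_in; have /imsetP[a _ e] := x_in.
by exists a; apply/eqP/val_inj; rewrite /= e.
Qed.

Lemma to_right_onto y : exists b, to_right b == y.
Proof.
case: y => x x_in; case e : (bwd i x) => [a|b].
  by case/setCP: (x_in); rewrite -(bwdK i x) e left_image_inl.
by exists b; apply/eqP/val_inj; rewrite /= -e bwdK.
Qed.

Definition left_iso := iso_of to_left_inj to_left_onto.
Definition right_iso := iso_of to_right_inj to_right_onto.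
End Pair.

Section PairTheory.
Variables F G : species.

(* The product structure given by f and g on the two sides of an arbitrary
   decomposition A + B of I. Iterated products then need no nested subset types:
   associativity becomes a statement about decompositions. *)
Definition pair_str (A B I : finType) (i : iso (A + B)%type I) (f : F A)
    (g : G B) : sp_mul F G I :=
  existT _ (left_image i) (transport (left_iso i) f, transport (right_iso i) g).

(** The types [part V] and [part W] differ until [V = W] is substituted; comparing values in [I]
    avoids a cast. *)
Lemma prod_str_eq2 (A B I : finType) (V W : {set I})
    (s : iso A (part V)) (s' : iso A (part W))
    (t : iso B (part (~: V))) (t' : iso B (part (~: W))) (f : F A) (g : G B) :
  V = W -> (forall a, val (s a) = val (s' a)) ->
  (forall b, val (t b) = val (t' b)) ->
  (existT _ V (transport s f, transport t g) : sp_mul F G I) =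
  existT _ W (transport s' f, transport t' g).
Proof.
move=> VW; case: W / VW s' t' => s' t' es et; apply: prod_str_congr.
  by apply: transport_ext => a; apply: val_inj; rewrite es.
by apply: transport_ext => b; apply: val_inj; rewrite et.
Qed.

(** Relabelling the two sides of a decomposition changes nothing, as long as every label ends at the
    same place in [I]. Most identities between product structures below reduce to this. *)
Lemma pair_str_eq (A B A' B' I : finType) (i : iso (A + B)%type I)
    (i' : iso (A' + B')%type I) (a : iso A A') (b : iso B B')
    (f : F A) (g : G B) :
  (forall x, i' (inl (a x)) = i (inl x)) ->
  (forall x, i' (inr (b x)) = i (inr x)) ->
  pair_str i' (transport a f) (transport b g) = pair_str i f g.
Proof.
move=> ea eb; rewrite /pair_str !transport_compE; apply: prod_str_eq2 => //.
apply/setP=> x; apply/imsetP/imsetP=> -[u _ ->].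
  by exists (bwd a u) => //; rewrite -ea bwdK.
by exists (a u).
Qed.

Lemma pair_str_ext (A B I : finType) (i i' : iso (A + B)%type I) (f : F A)
    (g : G B) : i =1 i' -> pair_str i f g = pair_str i' f g.
Proof.
move=> ii'; apply: prod_str_eq2 => [|a|b]; rewrite /= ?ii' //.
exact: eq_imset.
Qed.

Lemma transport_pair_str (A B I J : finType) (s : iso I J)
    (i : iso (A + B)%type I) (f : F A) (g : G B) :
  transport s (pair_str i f g) = pair_str (iso_comp s i) f g.
Proof.
rewrite /= !transport_compE; apply: prod_str_eq2 => //.
by rewrite /left_image -imset_comp.
Qed.

Definition part_sum (I : finType) (V : {set I})
    (x : (part V + part (~: V))%type) : I :=
  match x with inl u => val u | inr u => val u end.

Lemma part_sum_inj (I : finType) (V : {set I}) : injective (@part_sum I V).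
Proof.
move=> [[x xV]|[x xV]] [[y yV]|[y yV]] //= xy; try by congr (_ _); apply: val_inj.
  by case/setCP: (yV); rewrite -xy.
by case/setCP: (xV); rewrite xy.
Qed.

Lemma part_sum_onto (I : finType) (V : {set I}) x :
  exists u, @part_sum I V u == x.
Proof.
case: (boolP (x \in V)) => xV; first by exists (inl (exist _ x xV)).
by rewrite -in_setC in xV; exists (inr (exist _ x xV)).
Qed.

Definition part_sum_iso (I : finType) (V : {set I}) :=
  iso_of (@part_sum_inj I V) (part_sum_onto V).

Lemma pair_str_surj (I : finType) (V : {set I}) (f : F (part V))
    (g : G (part (~: V))) :
  pair_str (part_sum_iso V) f g = existT _ V (f, g).
Proof.
rewrite -[in RHS](transport1 f) -[in RHS](transport1 g).
apply: prod_str_eq2 => //; apply/setP=> x; apply/imsetP/idP => [[u _ ->]|xV].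
  exact: valP.
by exists (exist _ x xV).
Qed.
End PairTheory.

Definition sum_map (A A' B B' : Type) (s : A -> A') (t : B -> B') (x : A + B) :
    A' + B' :=
  match x with inl a => inl (s a) | inr b => inr (t b) end.

Definition sum_iso (A A' B B' : Type) (s : iso A A') (t : iso B B') :
  iso (A + B) (A' + B').
Proof.
exists (sum_map s t) (sum_map (bwd s) (bwd t)).
- by move=> [a|b] /=; rewrite fwdK.
- by move=> [a|b] /=; rewrite bwdK.
Defined.

Definition sum_swap (A B : Type) : iso (A + B) (B + A).
Proof.
by exists (fun x => match x with inl a => inr a | inr b => inl b end)
          (fun x => match x with inl a => inr a | inr b => inl b end); case.
Defined.

Definition sum_assoc (A B C : Type) : iso (A + (B + C)) (A + B + C).
Proof.
exists (fun x => match x with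
        | inl a => inl (inl a) | inr (inl b) => inl (inr b) | inr (inr c) => inr c
        end)
       (fun x => match x with
        | inl (inl a) => inl a | inl (inr b) => inr (inl b) | inr c => inr (inr c)
        end).
- by case=> [a|[b|c]].
- by case=> [[a|b]|c].
Defined.

Lemma sp_mul_pairP (F G : species) (I : finType) (x : sp_mul F G I) :
  exists (A B : finType) (i : iso (A + B)%type I) (f : F A) (g : G B),
    x = pair_str i f g.
Proof.
by case: x => V [f g]; do 5 eexists; apply/esym/pair_str_surj.
Qed.

(** * Commutativity, associativity and unit of the product *)

Section Commutativity.
Variables F G : species.

(** The swapped structure would need [~: ~: V] to be [V] by conversion; [pair_str] absorbs the
    difference. *)
Definition mul_swap (I : finType) (x : sp_mul F G I) : sp_mul G F I :=
  let: existT V (f, g) := x in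
  pair_str (iso_comp (part_sum_iso V) (sum_swap _ _)) g f.

Lemma mul_swap_pair (A B I : finType) (i : iso (A + B)%type I) f g :
  mul_swap (pair_str i f g) = pair_str (iso_comp i (sum_swap _ _)) g f.
Proof. exact: pair_str_eq. Qed.

Lemma mul_swap_surjection : natural_surjection (sp_mul F G) (sp_mul G F).
Proof.
exists mul_swap => [I J s x|I y].
  have [A [B [i [f [g ->]]]]] := sp_mul_pairP x.
  rewrite transport_pair_str !mul_swap_pair transport_pair_str.
  exact: pair_str_ext.
have [A [B [i [g [f ->]]]]] := sp_mul_pairP y.
exists (pair_str (iso_comp i (sum_swap _ _)) f g); rewrite mul_swap_pair.
by apply: pair_str_ext => -[].
Qed.
End Commutativity.

Lemma sp_mulC (F G : species) : species_iso (sp_mul F G) (sp_mul G F).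
Proof. by apply: natural_surjections_iso; apply: mul_swap_surjection. Qed.

Section Associativity.
Variables F G H : species.

Definition mul_assoc (I : finType) (x : sp_mul (sp_mul F G) H I) :
    sp_mul F (sp_mul G H) I :=
  let: existT V (existT W (f, g), h) := x in
  pair_str (iso_comp (iso_comp (part_sum_iso V)
                               (sum_iso (part_sum_iso W) (iso_id _)))
                     (sum_assoc _ _ _))
    f (pair_str (iso_id _) g h).

Lemma mul_assoc_pair (A B C D I : finType) (i : iso (C + D)%type I)
    (j : iso (A + B)%type C) f g h :
  mul_assoc (pair_str i (pair_str j f g) h) =
  pair_str (iso_comp (iso_comp i (sum_iso j (iso_id _))) (sum_assoc _ _ _))
    f (pair_str (iso_id _) g h).
Proof.
rewrite /= !transport_compE.
set b1 := iso_comp _ (right_iso j); set b2 := right_iso i.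
(* The inner pair lives on a sum of two subset types. It is the relabelling, along the bijections of
   the two blocks, of the pair on [B + D]. *)
rewrite (_ : pair_str _ _ (transport b2 h) =
  transport (sum_iso b1 b2) (pair_str (iso_id _) g h)); last first.
  by rewrite transport_pair_str; apply: (pair_str_eq (a := b1) (b := b2)).
by apply: (pair_str_eq (F := F) (G := sp_mul G H) (b := sum_iso b1 b2)) => // -[].
Qed.

Lemma mul_assoc_surjection :
  natural_surjection (sp_mul (sp_mul F G) H) (sp_mul F (sp_mul G H)).
Proof.
exists mul_assoc => [I J s x|I y].
  have [C [D [i [fg [h ->]]]]] := sp_mul_pairP x.
  have [A [B [j [f [g ->]]]]] := sp_mul_pairP fg.
  rewrite transport_pair_str !mul_assoc_pair transport_pair_str.
  exact: pair_str_ext.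
have [A [C [i [f [gh ->]]]]] := sp_mul_pairP y.
have [B [D [j [g [h ->]]]]] := sp_mul_pairP gh.
exists (pair_str (iso_comp (iso_comp i (sum_iso (iso_id _) j))
                    (iso_inv (sum_assoc _ _ _))) (pair_str (iso_id _) f g) h).
rewrite mul_assoc_pair -[in RHS](transport1 f).
rewrite (_ : pair_str j g h = transport j (pair_str (iso_id _) g h)); last first.
  by rewrite transport_pair_str; apply: pair_str_ext.
by apply/esym/pair_str_eq => // -[x|x].
Qed.
End Associativity.

Lemma natural_surjection_trans (F G H : species) :
  natural_surjection F G -> natural_surjection G H -> natural_surjection F H.
Proof.
move=> [phi nphi ophi] [psi npsi opsi]; exists (fun I => psi I \o phi I).
  by move=> I J s x /=; rewrite nphi npsi.
by move=> I z; have [y <-] := opsi I z; have [x <-] := ophi I y; exists x.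
Qed.

(** Commutativity reverses a triple product, so the surjection already built, applied to the
    reversed factors, also gives the opposite direction. *)
Lemma sp_mulA (F G H : species) :
  species_iso (sp_mul F (sp_mul G H)) (sp_mul (sp_mul F G) H).
Proof.
apply: natural_surjections_iso; last exact: mul_assoc_surjection.
have rev (F' G' H' : species) :
    species_iso (sp_mul F' (sp_mul G' H')) (sp_mul (sp_mul H' G') F').
  by rewrite (sp_mulC F') (sp_mulC G'); reflexivity.
apply: natural_surjection_trans (species_iso_surjection (rev _ _ _)) _.
apply: natural_surjection_trans (mul_assoc_surjection _ _ _) _.
by apply: species_iso_surjection; rewrite rev; reflexivity.
Qed.

Lemma card_str_pred (P : pred nat) (I : finType) (u : card_species P I) : P #|I|.
Proof. by case: u. Qed.

Section Unit.
Variable F : species.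

Lemma full_part_inj (I : finType) (V : {set I}) :
  injective (val : part (~: V) -> I).
Proof. exact: val_inj. Qed.

Lemma full_part_onto (I : finType) (V : {set I}) (u : sp_one (part V)) x :
  exists y : part (~: V), val y == x.
Proof.
suff xV : x \in ~: V by exists (exist _ x xV).
apply/setCP=> xV; have /eqP/card0_eq := card_str_pred u.
by move/(_ (exist _ x xV)); rewrite inE.
Qed.

Definition mul_one (I : finType) (x : sp_mul sp_one F I) : F I :=
  let: existT V (u, f) := x in
  transport (iso_of (@full_part_inj I V) (full_part_onto u)) f.

Definition void_sum (I : Type) : iso (void + I) I.
Proof.
by exists (fun x : void + I =>
    match x with inl u => of_void I u | inr y => y end) inr
  => // -[[]|].
Defined.

Lemma card_void_one : pred1 0 #|void : finType|.
Proof. by rewrite /= card_void. Qed.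

Definition one_void : sp_one (void : finType) :=
  exist (fun=> pred1 0 _) tt card_void_one.

Definition one_mul (I : finType) (x : F I) : sp_mul sp_one F I :=
  pair_str (void_sum I) one_void x.

Lemma sp_mul1 : species_iso (sp_mul sp_one F) F.
Proof.
apply: natural_surjections_iso.
  exists mul_one => [I J s [V [u f]]|I y].
    rewrite /mul_one /= !transport_compE; exact: transport_ext.
  exists (one_mul y); rewrite /mul_one /one_mul /= transport_compE.
  exact: transport_eq_id.
exists one_mul => [I J s x|I [V [u f]]].
  rewrite /one_mul transport_pair_str -[in LHS](transport1 one_void).
  exact: pair_str_eq.
have /eqP u0 := card_str_pred u.
exists (transport (iso_of (@full_part_inj I V) (full_part_onto u)) f).
have nV (x : part V) : False by have := card0_eq u0 x; rewrite inE.
pose w x : void := match nV x with end.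
have wK : cancel w (of_void _) by move=> x; case: (nV x).
have w'K : cancel (of_void _) w by case.
rewrite /one_mul -pair_str_surj.
rewrite (card_str_eq one_void (transport (Iso wK w'K) u)).
by apply: pair_str_eq => // x; case: (nV x).
Qed.
End Unit.

(** * The semiring of species up to isomorphism *)

Lemma sp_addC (F G : species) : species_iso (sp_add F G) (sp_add G F).
Proof.
have swap F' G' : natural_surjection (sp_add F' G') (sp_add G' F').
  exists (fun I (x : sp_add F' G' I) =>
    match x return sp_add G' F' I with inl f => inr f | inr g => inl g end).
    by move=> I J s [f|g].
  by move=> I [g|f]; [exists (inr g) | exists (inl f)].
by apply: natural_surjections_iso.
Qed.

Lemma sp_addA (F G H : species) :
  species_iso (sp_add F (sp_add G H)) (sp_add (sp_add F G) H).
Proof.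
exists (fun I => sum_assoc (F I) (G I) (H I)).
by move=> I J s [f|[g|h]].
Qed.

Lemma sp_add0 (F : species) : species_iso (sp_add sp_zero F) F.
Proof. by exists (fun I => void_sum (F I)) => I J s [[]|f]. Qed.

Lemma sp_mul0 (F : species) : species_iso (sp_mul sp_zero F) sp_zero.
Proof.
apply: natural_surjections_iso.
  by exists (fun I (x : sp_mul sp_zero F I) =>
    match (projT2 x).1 return void with end) => [I J s [V []]|I []].
by exists (fun I (x : sp_zero I) =>
  match x return sp_mul sp_zero F I with end) => [I J s []|I [V [[]]]].
Qed.

Lemma sp_mulDl (F G H : species) :
  species_iso (sp_mul (sp_add F G) H) (sp_add (sp_mul F H) (sp_mul G H)).
Proof.
apply: natural_surjections_iso.
  exists (fun I (x : sp_mul (sp_add F G) H I) =>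
    match x return sp_add (sp_mul F H) (sp_mul G H) I with
    | existT V (inl f, h) => inl (existT _ V (f, h))
    | existT V (inr g, h) => inr (existT _ V (g, h))
    end) => [I J s [V [[f|g] h]] //|I [[V [f h]]|[V [g h]]]].
    by exists (existT _ V (inl f, h)).
  by exists (existT _ V (inr g, h)).
exists (fun I (x : sp_add (sp_mul F H) (sp_mul G H) I) =>
  match x return sp_mul (sp_add F G) H I with
  | inl (existT V (f, h)) => existT _ V (inl f, h)
  | inr (existT V (g, h)) => existT _ V (inr g, h)
  end) => [I J s [[V [f h]]|[V [g h]]] //|I [V [[f|g] h]]].
  by exists (inl (existT _ V (f, h))).
by exists (inr (existT _ V (g, h))).
Qed.

Lemma species_semi_ring :
  semi_ring_theory sp_zero sp_one sp_add sp_mul species_iso.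
Proof.
split; [exact: sp_add0|exact: sp_addC|exact: sp_addA|exact: sp_mul1|
  exact: sp_mul0|exact: sp_mulC|exact: sp_mulA|exact: sp_mulDl].
Qed.

Lemma species_ring_eq_ext : sring_eq_ext sp_add sp_mul species_iso.
Proof. by split; [exact: sp_add_proper|exact: sp_mul_proper]. Qed.

Add Ring species_ring : species_semi_ring
  (setoid species_iso_equiv species_ring_eq_ext).

(** * Cancellation *)

(* If phi is a natural bijection from F + H onto G + H, then iterating phi from
   a structure of F until a structure of G is met is natural, since no choice is
   involved; finiteness of H makes the iteration stop. *)
Section Cancellation.
Variables F G H : species.
Variable phi : forall I : finType, iso (sp_add F H I) (sp_add G H I).
Hypothesis phi_natural : natural phi.

Fixpoint chain (I : finType) (n : nat) (x : sp_add F H I) (y : sp_add G H I) :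
    Prop :=
  match n with
  | 0 => phi I x = y
  | n'.+1 => exists2 h : H I, chain n' x (inr h) & phi I (inr h) = y
  end.

(** As [phi] is injective, a path can be retraced from its end. Retracing two paths with a common
    end, the shorter one either is the whole longer one or starts strictly inside it, hence in
    [H]. *)
Lemma chain_inj (I : finType) n m (x x' : sp_add F H I) y :
  chain n x y -> chain m x' y -> n <= m ->
  (n = m /\ x = x') \/ exists h, x = inr h.
Proof.
elim: n m y => [|n IH] [|m] y //=.
- by move=> <- e _; left; rewrite (iso_inj e).
- by move=> <- [h _ e] _; right; exists h; rewrite (iso_inj e).
- move=> [h ch <-] [h' ch' e]; have [eh] := iso_inj e; rewrite eh in ch'.
  by rewrite ltnS => /(IH _ _ ch ch')[[-> ->]|]; [left|right].
Qed.

(** Structures of [G] are fixed, so overshooting is harmless and one number of steps serves all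
    starting points. *)
Definition step (I : finType) (y : sp_add G H I) : sp_add G H I :=
  match y with inl g => inl g | inr h => phi I (inr h) end.

Definition walk (I : finType) (f : F I) n : sp_add G H I :=
  iter n (@step I) (phi I (inl f)).

Lemma walk_natural (I J : finType) (s : iso I J) (f : F I) n :
  walk (transport s f) n = transport s (walk f n).
Proof.
elim: n => [|n IH]; first exact: (phi_natural s (inl f)).
rewrite /walk !iterS -!/(walk _ _) IH; case: (walk f n) => // h.
exact: (phi_natural s (inr h)).
Qed.

Lemma walk_chain (I : finType) (f : F I) n :
  match walk f n with
  | inl g => exists m, chain m (inl f) (inl g)
  | inr h => chain n (inl f) (inr h)
  end.
Proof.
elim: n => [|n].
  by rewrite /walk /=; case e: (phi _ _) => [g|h] //; exists 0.
rewrite /walk iterS -/(walk f n); case: (walk f n) => [g|h] //= ch.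
case e: (phi _ _) => [g|h']; last by exists h.
by exists n.+1; exists h.
Qed.

Lemma walk_inr_leq (I : finType) (f : F I) n m h :
  m <= n -> walk f n = inr h -> exists h', walk f m = inr h'.
Proof.
move=> mn; rewrite -(subnK mn) /walk iterD -/(walk f m).
case: (walk f m) => [g|h' _]; last by exists h'.
suff -> : iter (n - m) (@step I) (inl g) = inl g by [].
by elim: (n - m) => //= k ->.
Qed.

(** Pigeonhole: a walk still in [H I] after [#|H I|] steps would have visited [#|H I|.+1] structures
    of [H I], pairwise distinct by [chain_inj] because the start [inl f] is not in [H]. *)
Lemma walk_stops (I : finType) (f : F I) : {g | walk f #|H I| = inl g}.
Proof.
case e: (walk f #|H I|) => [g|h]; first by exists g.
have w (k : 'I_#|H I|.+1) : exists h', walk f k = inr h'.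
  by apply: walk_inr_leq e; rewrite -ltnS.
have w' (k : 'I_#|H I|.+1) : exists h', walk f k == inr h'.
  by have [h' ->] := w k; exists h'.
pose hk k := xchoose (w' k).
have hkP (k : 'I_#|H I|.+1) : chain k (inl f) (inr (hk k)).
  by have := walk_chain f k; rewrite (eqP (xchooseP (w' k))).
have inj_hk : injective hk.
  move=> i j eij; apply: val_inj; wlog ij : i j eij / i <= j.
    by move=> wl; case/orP: (leq_total i j) => /wl; [apply|move/(_ (esym eij))].
  by have := chain_inj (hkP i); rewrite eij => /(_ _ _ (hkP j) ij)[[]|[]].
by have := leq_card hk inj_hk; rewrite card_ord ltnn.
Qed.
End Cancellation.

(** The end of the walk depends injectively on its start, again by [chain_inj]; surjectivity follows
    by counting, since [F I] and [G I] have equal size. *)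
Lemma sp_addIr (H F G : species) :
  species_iso (sp_add F H) (sp_add G H) -> species_iso F G.
Proof.
case=> phi nphi.
pose psi I (f : F I) : G I := sval (walk_stops phi f).
have psiP I (f : F I) : walk phi f #|H I| = inl (psi I f).
  exact: (svalP (walk_stops phi f)).
have cardFG I : #|G I| <= #|F I|.
  have : #|sp_add F H I| = #|sp_add G H I| by exact: (iso_card (phi I)).
  by rewrite !card_sum => /addIn->.
have source_inj I (f f' : F I) n m y :
    chain phi n (inl f) y -> chain phi m (inl f') y -> n <= m -> f = f'.
  by move=> cn cm nm; case: (chain_inj cn cm nm) => [[_ []]|[]].
have psi_inj I : injective (psi I).
  move=> f f' e.
  have := walk_chain phi f #|H I|; have := walk_chain phi f' #|H I|.
  rewrite !psiP e => -[m cm] [n cn]; case/orP: (leq_total n m).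
    exact: source_inj cn cm.
  by move=> mn; apply/esym/(source_inj _ _ _ _ _ _ cm cn).
apply: (natural_bij_iso (phi := psi)) => // [I J s f|I y].
  have : inl (psi J (transport s f)) = inl (transport s (psi I f)) :> sp_add G H J.
    (* The walks on [I] and [J] must have the same length; transport of [H] is a bijection, so they
       do. *)
    rewrite -psiP walk_natural // (_ : #|H J| = #|H I|) ?psiP //.
    apply/esym/(bij_eq_card (f := @transport H _ _ s)).
  exact: Bijective (@transport_invK H _ _ s) (@transportKinv H _ _ s).
  by case.
have /codomP[x ->] := inj_card_onto (@psi_inj I) (cardFG I) y.
by exists x.
Qed.

(** * The ring of virtual species *)

Local Notation "0" := sp_zero : species_scope.
Local Notation "1" := sp_one : species_scope.
Local Notation "F + G" := (sp_add F G) : species_scope.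
Local Notation "F * G" := (sp_mul F G) : species_scope.
Delimit Scope species_scope with S.

(** For transitivity, adding the two isomorphisms leaves [vpos G + vneg G] on both sides, and this
    is cancelled. *)
#[global] Instance veq_equiv : Equivalence veq.
Proof.
split.
- by move=> F; rewrite /veq; reflexivity.
- by move=> F G FG; rewrite /veq; symmetry.
- move=> F G H FG GH; rewrite /veq in FG GH *.
  apply: (sp_addIr (H := (vpos G + vneg G)%S)).
  transitivity ((vpos F + vneg G) + (vpos G + vneg H))%S; first by ring.
  by rewrite FG GH; ring.
Qed.

#[global] Instance vadd_proper : Proper (veq ==> veq ==> veq) vadd.
Proof.
move=> F F' FF' G G' GG'; rewrite /veq /= in FF' GG' *.
transitivity ((vpos F + vneg F') + (vpos G + vneg G'))%S; first by ring.
by rewrite FF' GG'; ring.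
Qed.

#[global] Instance vopp_proper : Proper (veq ==> veq) vopp.
Proof.
move=> F F' FF'; rewrite /veq /= in FF' *.
transitivity (vpos F' + vneg F)%S; first by ring.
by rewrite -FF'; ring.
Qed.

#[global] Instance vsub_proper : Proper (veq ==> veq ==> veq) vsub.
Proof. by move=> F F' FF' G G' GG'; rewrite /vsub FF' GG'; reflexivity. Qed.

Lemma vmulC (F G : vspecies) : veq (vmul F G) (vmul G F).
Proof. by rewrite /veq /=; ring. Qed.

Lemma vmul_congl (F F' G : vspecies) :
  veq F F' -> veq (vmul F G) (vmul F' G).
Proof.
move=> FF'; rewrite /veq /= in FF' *.
transitivity ((vpos F + vneg F') * vpos G + (vpos F' + vneg F) * vneg G)%S.
  by ring.
transitivity ((vpos F' + vneg F) * vpos G + (vpos F + vneg F') * vneg G)%S.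
  by rewrite FF'; reflexivity.
by ring.
Qed.

#[global] Instance vmul_proper : Proper (veq ==> veq ==> veq) vmul.
Proof.
move=> F F' FF' G G' GG'; transitivity (vmul F' G); first exact: vmul_congl.
by rewrite (vmulC F') (vmulC F'); apply: vmul_congl.
Qed.

Lemma vspecies_ring_theory :
  ring_theory (virt sp_zero) (virt sp_one) vadd vmul vsub vopp veq.
Proof. by split=> *; rewrite /veq /=; ring. Qed.

Lemma vspecies_ring_eq_ext : ring_eq_ext vadd vmul vopp veq.
Proof. by split; [exact: vadd_proper|exact: vmul_proper|exact: vopp_proper]. Qed.

Add Ring vspecies_ring : vspecies_ring_theory
  (setoid veq_equiv vspecies_ring_eq_ext).

Lemma virt_iso (F G : species) : species_iso F G -> veq (virt F) (virt G).
Proof. by move=> FG; rewrite /veq /= FG; reflexivity. Qed.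

Lemma virt_add (F G : species) : veq (virt (F + G)%S) (vadd (virt F) (virt G)).
Proof. by rewrite /veq /=; ring. Qed.

Lemma virt_mul (F G : species) : veq (virt (F * G)%S) (vmul (virt F) (virt G)).
Proof. by rewrite /veq /=; ring. Qed.

Lemma vmul_vinv (F G : vspecies) :
  veq (vmul F G) (virt sp_one) -> veq (vmul F (vinv F)) (virt sp_one).
Proof.
move=> FG; rewrite /vinv; apply: (epsilon_spec (inhabits (vnat 0))
  (fun G => veq (vmul F G) (virt sp_one))).
by exists G.
Qed.

(** * Sequences of nonempty structures *)

Section Sequences.
Variable P : species.
Hypothesis P0 : forall I : finType, P I -> 0 < #|I|.

Definition sp_pow (k : nat) : species := iter k (sp_mul P) sp_one.

(** Each of the [k] factors uses at least one label. The bound makes the sequences on [I] a finite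
    type, and has the form that [Ordinal] expects. *)
Lemma sp_pow_card k (I : finType) (x : sp_pow k I) : k < #|I|.+1.
Proof.
rewrite ltnS; elim: k I x => // k IH I [V [p x]].
rewrite -(iso_card (part_sum_iso V)) card_sum -(add1n k).
exact: leq_add (P0 p) (IH _ x).
Qed.

Definition seq_str (I : finType) : finType := {k : 'I_#|I|.+1 & sp_pow k I}.

Definition seq_in k (I : finType) (x : sp_pow k I) : seq_str I :=
  existT (fun k : 'I_#|I|.+1 => sp_pow k I) (Ordinal (sp_pow_card x)) x.

Lemma seq_inE k (I : finType) (lt_k : k < #|I|.+1) (x : sp_pow k I) :
  existT (fun k : 'I_#|I|.+1 => sp_pow k I) (Ordinal lt_k) x = seq_in x.
Proof. by rewrite /seq_in (bool_irrelevance lt_k (sp_pow_card x)). Qed.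

Lemma seq_strP (I : finType) (y : seq_str I) :
  exists k (x : sp_pow k I), y = seq_in x.
Proof. by case: y => -[k lt_k] x; exists k, x; rewrite seq_inE. Qed.

Definition seq_transport (I J : finType) (s : iso I J) (y : seq_str I) :
    seq_str J :=
  let: existT k x := y in seq_in (transport s x).

Definition sp_seq : species.
Proof.
exists seq_str seq_transport.
- by move=> I J s t st [k x] /=; rewrite (transport_ext st).
- by move=> I [[k lt_k] x] /=; rewrite transport_id seq_inE.
- by move=> I J K t s [k x] /=; rewrite transport_comp.
Defined.

Definition unseq (I : finType) (y : seq_str I) :
    sp_add sp_one (sp_mul P sp_seq) I :=
  let: existT k x := y in
  match (k : nat) as n return sp_pow n I -> sp_add sp_one (sp_mul P sp_seq) I with
  | 0 => fun u => inl u
  | n.+1 => fun x => let: existT V (p, x') := x in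
                     inr (existT _ V (p, seq_in x' : sp_seq _))
  end x.

Definition enseq (I : finType) (y : sp_add sp_one (sp_mul P sp_seq) I) :
    sp_seq I :=
  match y with
  | inl u => @seq_in 0 I u
  | inr (existT V (p, existT k x)) => @seq_in k.+1 I (existT _ V (p, x))
  end.

Lemma sp_seqE : species_iso sp_seq (sp_add sp_one (sp_mul P sp_seq)).
Proof.
apply: natural_surjections_iso.
  exists unseq => [I J s y|I [u|[V [p y]]]].
  - by have [[|k] [x ->]] := seq_strP y; last by case: x => V [p x].
  - by exists (@seq_in 0 I u).
  - have [k [x ->]] := seq_strP y.
    by exists (@seq_in k.+1 I (existT _ V (p, x))).
exists enseq => [I J s [u|[V [p [k x]]]]//|I y].
have [[|k] [x ->]] := seq_strP y; first by exists (inl x).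
by case: x => V [p x]; exists (inr (existT _ V (p, seq_in x : sp_seq _))).
Qed.
End Sequences.

(** The inverse is the geometric series [Y] of [P], which satisfies [Y = 1 + P * Y]. *)
Lemma one_sub_invertible (P : species) :
  (forall I : finType, P I -> 0 < #|I|) ->
  exists Y, veq (vmul (vsub (virt sp_one) (virt P)) Y) (virt sp_one).
Proof.
move=> P0; exists (virt (sp_seq P0)).
have e := virt_iso (sp_seqE P0); rewrite virt_add virt_mul in e.
set Y := virt (sp_seq _) in e *.
transitivity (vsub Y (vmul (virt P) Y)); first by ring.
by rewrite {1}e; ring.
Qed.

Definition card_in (P : pred nat) (I : finType) (h : P #|I|) :
  card_species P I := exist (fun=> P #|I|) tt h.

Definition sp_Eplus : species := card_species (fun n => n != 0).

Lemma sp_E_split : species_iso sp_E (sp_add sp_one sp_Eplus).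
Proof.
have uniq I (x y : sp_add sp_one sp_Eplus I) : x = y.
  case: x y => [u|u] [v|v]; try by rewrite (card_str_eq u v).
    by case/negP: (card_str_pred v); apply: card_str_pred u.
  by case/negP: (card_str_pred u); apply: card_str_pred v.
have choice (I : finType) : sp_add sp_one sp_Eplus I.
  by case: (boolP (#|I| == 0)) => e; [left|right]; apply: (card_in e).
apply: natural_surjections_iso.
  exists (fun I _ => choice I) => [I J s x|I y]; first exact: uniq.
  by exists (@card_in predT I isT); apply: uniq.
exists (fun I _ => @card_in predT I isT) => [I J s x|I y].
  exact: card_str_eq.
by exists (choice I); apply: card_str_eq.
Qed.

(* With E = 1 + P, the inverse of E is (1 - P) / (1 - P^2), and 1 / (1 - P^2) is
   the species of sequences of structures of P^2. *)
Lemma one_sub_X_E_invertible :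
  exists G, veq (vmul (vmul (vsub (virt sp_one) (virt sp_X)) (virt sp_E)) G)
                (virt sp_one).
Proof.
have [|L XL] := @one_sub_invertible sp_X.
  by move=> I /card_str_pred/eqP->.
have [|Y EY] := @one_sub_invertible (sp_mul sp_Eplus sp_Eplus).
  move=> I [V [u _]]; rewrite -(iso_card (part_sum_iso V)) card_sum addn_gt0.
  by rewrite lt0n (card_str_pred u).
rewrite virt_mul in EY.
have E_split := virt_iso sp_E_split; rewrite virt_add in E_split.
set Ep := virt sp_Eplus in E_split EY.
exists (vmul L (vmul (vsub (virt sp_one) Ep) Y)); rewrite E_split.
transitivity (vmul (vmul (vsub (virt sp_one) (virt sp_X)) L)
  (vmul (vsub (virt sp_one) (vmul Ep Ep)) Y)); first by ring.
by rewrite XL EY; ring.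
Qed.

(** * The clique sides of a split graph *)

Section KS.
Variables (I : finType) (e : edge_rel I).

Definition ks (K : {set I}) : bool := KS_partition e (K, ~: K).

Lemma KS_partitionE (K S : {set I}) :
  KS_partition e (K, S) = (S == ~: K) && ks K.
Proof.
apply/idP/andP => [h|[/eqP-> //]].
suff S_K : S = ~: K by move: h; rewrite S_K eqxx.
case/and4P: h => /eqP KS dKS _ _; apply/setP=> x; rewrite inE.
case: (boolP (x \in K)) => xK; first by rewrite (disjointFr dKS).
by have /setP/(_ x) := KS; rewrite !inE (negbTE xK).
Qed.

Hypothesis e_simple : simple_graph e.

Lemma simple_irr x : e (x, x) = false.
Proof. by case/andP: e_simple => /forallP/(_ x)/negbTE. Qed.

Lemma simple_sym x y : e (x, y) = e (y, x).
Proof. by case/andP: e_simple => _ /forallP/(_ x)/forallP/(_ y)/eqP. Qed.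

(** Treating both sides at once gives a condition symmetric under complementing graph and side.
    Irreflexivity supplies the diagonal pairs, which [stable] also tests. *)
Lemma ksP (K : {set I}) :
  reflect (forall x y, x != y -> (x \in K) = (y \in K) -> e (x, y) = (x \in K))
          (ks K).
Proof.
rewrite /ks /KS_partition /= setUCr eqxx -setI_eq0 setICr eqxx /=.
apply: (iffP andP) => [[cK sK] x y xy|h].
  case: (boolP (x \in K)) => xK /esym yK.
    by move/forall_inP: cK => /(_ x xK)/forall_inP/(_ y yK)/implyP->.
  move/forall_inP: sK => /(_ x); rewrite inE => /(_ xK)/forall_inP/(_ y).
  by rewrite inE yK => /(_ isT)/negbTE.
split; apply/forall_inP=> x; rewrite ?inE => xK;
  apply/forall_inP=> y; rewrite ?inE => yK.
  by apply/implyP=> xy; rewrite h ?xK ?yK.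
have [<-|xy] := eqVneq x y; first by rewrite simple_irr.
by rewrite h // (negbTE xK) // (negbTE yK).
Qed.

(** Two distinct such vertices would be adjacent, as members of the clique [K], and not adjacent, as
    members of the stable side of [K']. *)
Lemma ks_diff (K K' : {set I}) x y :
  ks K -> ks K' -> x \in K -> x \notin K' -> y \in K -> y \notin K' -> x = y.
Proof.
move=> /ksP hK /ksP hK' xK xK' yK yK'; apply/eqP/negPn/negP=> xy.
have := hK x y xy; rewrite xK yK => /(_ erefl).
by rewrite hK' // (negbTE xK') // (negbTE yK').
Qed.

Lemma ks_proper_card (K K' : {set I}) :
  ks K -> ks K' -> K' \proper K -> #|K| = #|K'|.+1.
Proof.
move=> hK hK' /properP[K'K [x xK xK']].
suff -> : K = x |: K' by rewrite cardsU1 xK'.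
apply/setP=> y; rewrite !inE; have [->|yx] //= := eqVneq y x.
apply/idP/idP => [yK|]; last exact: (subsetP K'K).
apply/negPn/negP=> yK'; case/eqP: yx.
exact: ks_diff hK hK' yK yK' xK xK'.
Qed.

Definition nested (K K' : {set I}) := (K \subset K') || (K' \subset K).

Lemma nested_sym K K' : nested K K' = nested K' K.
Proof. exact: orbC. Qed.

Lemma nested_card (K K' : {set I}) : ks K -> ks K' -> nested K K' ->
  K != K' -> (#|K| == #|K'|.+1) || (#|K'| == #|K|.+1).
Proof.
move=> hK hK' /orP[KK'|K'K] ne; apply/orP; [right|left]; apply/eqP;
  apply: ks_proper_card => //; by rewrite properEneq ?KK' ?K'K ?ne // eq_sym ne.
Qed.

(* The sizes of nested clique sides differ by exactly one. *)
Lemma no_three_nested (K1 K2 K3 : {set I}) :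
  ks K1 -> ks K2 -> ks K3 ->
  nested K1 K2 -> nested K2 K3 -> nested K1 K3 ->
  K1 != K2 -> K2 != K3 -> K1 == K3.
Proof.
move=> h1 h2 h3 c12 c23 c13 n12 n23; apply/negPn/negP=> n13.
have := nested_card h1 h2 c12 n12; have := nested_card h2 h3 c23 n23.
have := nested_card h1 h3 c13 n13.
by do 3 (case/orP=> /eqP ?); lia.
Qed.

(** By [ks_diff], [K] and [K'] arise from their intersection by adding single vertices [a] and [b].
    If [a] and [b] are adjacent the union is a clique side, otherwise the intersection is. *)
Lemma ks_setU_or_setI (K K' : {set I}) :
  ks K -> ks K' -> ~~ nested K K' -> ks (K :|: K') || ks (K :&: K').
Proof.
move=> hK hK'; rewrite negb_or => /andP[/subsetPn[a aK aK'] /subsetPn[b bK' bK]].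
have eqa x : x \in K -> x \notin K' -> x = a.
  by move=> xK xK'; apply: ks_diff hK hK' xK xK' aK aK'.
have eqb x : x \in K' -> x \notin K -> x = b.
  by move=> xK' xK; apply: ks_diff hK' hK xK' xK bK' bK.
move/ksP: hK => hK; move/ksP: hK' => hK'.
case: (boolP (e (a, b))) => eab; apply/orP; [left|right]; apply/ksP=> x y xy;
  rewrite !inE;
  move: (hK x y xy) (hK' x y xy) (eqa x) (eqa y) (eqb x) (eqb y);
  case: (x \in K); case: (x \in K'); case: (y \in K); case: (y \in K') => //=;
  move=> h1 h2 h3 h4 h5 h6 _; try by [rewrite h1 | rewrite h2].
(* The surviving pairs have one vertex in [K] only and the other in [K'] only, so they are [a] and
   [b] in some order. *)
- by rewrite h3 // h6.
- by rewrite simple_sym h4 // h5.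
- by rewrite h3 // h6 // (negbTE eab).
- by rewrite simple_sym h4 // h5 // (negbTE eab).
Qed.

(* The tie-break in the second conjunct picks the larger of exactly two clique
   sides. *)
Definition central (K : {set I}) : bool :=
  [forall K', ks K' ==> nested K K'] &&
  [forall K', ks K' && (K \proper K') ==>
     [exists K'', [&& ks K'', K'' != K & K'' != K']]].

(** Two distinct central sides are nested, and the tie-break of the smaller one yields a third side,
    nested with both; this contradicts [no_three_nested]. *)
Lemma central_unique (K K' : {set I}) :
  ks K -> ks K' -> central K -> central K' -> K = K'.
Proof.
wlog le_KK' : K K' / #|K| <= #|K'|.
  move=> wl hK hK' cK cK'; case/orP: (leq_total #|K| #|K'|) => ?.
    exact: wl.
  exact/esym/wl.
move=> hK hK' /andP[/forallP cK /forallP tK] /andP[/forallP cK' _].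
apply/eqP/negPn/negP=> ne.
have c : nested K K' by have := cK K'; rewrite hK'.
have /existsP[L /and3P[hL LK LK']] : [exists L, [&& ks L, L != K & L != K']].
  apply: (implyP (tK K')); rewrite hK' properEneq ne /=.
  case/orP: c => // K'K; case/eqP: ne; apply/esym/eqP.
  by rewrite eqEcard K'K.
have cKL : nested K L by have := cK L; rewrite hL.
have cK'L : nested K' L by have := cK' L; rewrite hL.
have := no_three_nested hK hK' hL c cK'L cKL ne.
by rewrite eq_sym LK' => /(_ isT); rewrite eq_sym (negbTE LK).
Qed.

(** If [L] is not nested with the union, only one vertex [x] of the union is missing from [L], so
    [a] or [b] lies in [L]. Some [y] of [L] lies outside the union: it is adjacent to that vertex
    within [L], yet both are on the stable side of [K'] or of [K]. *)
Lemma setU_central (K K' : {set I}) : ks K -> ks K' -> ~~ nested K K' ->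
  ks (K :|: K') -> forall L, ks L -> nested (K :|: K') L.
Proof.
move=> hK hK' + hU L hL; rewrite negb_or.
move=> /andP[/subsetPn[a aK aK'] /subsetPn[b bK' bK]].
apply/negPn/negP; rewrite negb_or.
move=> /andP[/subsetPn[x xU xL] /subsetPn[y yL yU]].
have inL z : z \in K :|: K' -> z != x -> z \in L.
  move=> zU zx; apply/negPn/negP=> zL; case/eqP: zx.
  exact: ks_diff hU hL zU zL xU xL.
move: (yU); rewrite inE negb_or => /andP[yK yK'].
have bad z K0 :
    ks K0 -> z \in K :|: K' -> z != x -> z \notin K0 -> y \notin K0 -> False.
  move=> /ksP h0 zU zx zK0 yK0; have zy : z != y.
    by apply: contraNneq yU => <-.
  have := h0 z y zy; rewrite (negbTE zK0) (negbTE yK0) => /(_ erefl).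
  have zL := inL z zU zx.
  by move/ksP: hL => ->; rewrite ?zL.
have [ax|ax] := eqVneq a x.
  apply: (bad b K) => //; first by rewrite inE bK' orbT.
  by apply: contraNneq bK => ->; rewrite -ax.
by apply: (bad a K') => //; rewrite inE aK.
Qed.

(** Dual argument: [a] or [b] lies outside [L], as does some [x] of the intersection. The two share
    the clique [K] or [K'] but are both on the stable side of [L]. *)
Lemma setI_central (K K' : {set I}) : ks K -> ks K' -> ~~ nested K K' ->
  ks (K :&: K') -> forall L, ks L -> nested (K :&: K') L.
Proof.
move=> hK hK' + hU L hL; rewrite negb_or.
move=> /andP[/subsetPn[a aK aK'] /subsetPn[b bK' bK]].
apply/negPn/negP; rewrite negb_or.
move=> /andP[/subsetPn[x xU xL] /subsetPn[y yL yU]].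
have notinL z : z \notin K :&: K' -> z != y -> z \notin L.
  move=> zU zy; apply/negP=> zL; case/eqP: zy.
  exact: ks_diff hL hU zL zU yL yU.
move: (xU); rewrite inE => /andP[xK xK'].
have bad z K0 :
    ks K0 -> z \notin K :&: K' -> z != y -> z \in K0 -> x \in K0 -> False.
  move=> /ksP h0 zU zy zK0 xK0; have zx : z != x.
    by apply: contraNneq zU => ->.
  have := h0 z x zx; rewrite zK0 xK0 => /(_ erefl).
  have /negbTE zL := notinL z zU zy.
  by move/ksP: hL => ->; rewrite ?zL // (negbTE xL).
have [ay|ay] := eqVneq a y.
  apply: (bad b K') => //; first by rewrite inE (negbTE bK).
  by apply: contraNneq bK => ->; rewrite -ay.
by apply: (bad a K) => //; rewrite inE (negbTE aK') andbF.
Qed.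

(** If two sides are not nested, their union or intersection is central: it differs from both, so
    for any larger side one of the two is the third side the tie-break asks for. If all sides are
    nested, a largest one is central, as nothing lies above it. *)
Lemma central_exists (K : {set I}) : ks K -> exists2 M, ks M & central M.
Proof.
move=> hK.
case: (boolP [exists K1, exists K2, [&& ks K1, ks K2 & ~~ nested K1 K2]]).
  move=> /existsP[K1 /existsP[K2 /and3P[h1 h2 nc]]].
  have [M [hM cM n1 n2]] : exists M, [/\ ks M, forall L, ks L -> nested M L,
      M != K1 & M != K2].
    have := nc; rewrite negb_or => /andP[s12 s21].
    case/orP: (ks_setU_or_setI h1 h2 nc) => hM;
      [exists (K1 :|: K2)|exists (K1 :&: K2)];
      split=> //.
    - exact: setU_central.
    - by apply: contraNneq s21 => <-; apply: subsetUr.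
    - by apply: contraNneq s12 => <-; apply: subsetUl.
    - exact: setI_central.
    - by apply: contraNneq s12 => <-; apply: subsetIr.
    - by apply: contraNneq s21 => <-; apply: subsetIl.
  exists M => //; apply/andP; split.
    by apply/forallP=> L; apply/implyP; apply: cM.
  apply/forallP=> L; apply/implyP=> /andP[hL ML]; apply/existsP.
  have [L1|L1] := eqVneq K1 L; last by exists K1; rewrite h1 eq_sym n1.
  exists K2; rewrite h2 eq_sym n2 -L1 /=; apply: contraNneq nc => ->.
  by rewrite /nested subxx.
move=> nc; have [M hM maxM] := arg_maxnP (fun K : {set I} => #|K|) hK.
exists M => //; apply/andP; split; apply/forallP=> L; apply/implyP.
  move=> hL; move: nc; rewrite negb_exists => /forallP/(_ M).
  by rewrite negb_exists => /forallP/(_ L); rewrite hM hL /= negbK.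
by case/andP=> /maxM le_LM /proper_card; rewrite ltnNge [_ <= _]le_LM.
Qed.

Definition below (K : {set I}) := [exists K', ks K' && (K' \proper K)].
Definition above (K : {set I}) := [exists K', ks K' && (K \proper K')].
Definition rigid (K : {set I}) := [forall K', ks K' ==> (K' == K)].

Lemma not_rigid (K : {set I}) : ks K -> ~~ rigid K = below K || above K.
Proof.
move=> hK; rewrite negb_forall; apply/existsP/orP => [[L]|].
  rewrite negb_imply => /andP[hL LK].
  case: (boolP (nested K L)) => [/orP[s|s]|nc].
  - by right; apply/existsP; exists L; rewrite hL properEneq eq_sym LK.
  - by left; apply/existsP; exists L; rewrite hL properEneq LK.
  have := nc; rewrite negb_or => /andP[sKL sLK].
  case/orP: (ks_setU_or_setI hK hL nc) => h.
    right; apply/existsP; exists (K :|: L); rewrite h properE subsetUl.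
    by rewrite subUset subxx.
  left; apply/existsP; exists (K :&: L); rewrite h properE subsetIl.
  by rewrite subsetI subxx.
by case=> /existsP[L /andP[hL]]; rewrite properEneq => /andP[ne _]; exists L;
  rewrite hL // 1?eq_sym.
Qed.

(** Sides below and above [K] would be nested with sizes differing by two instead of one. *)
Lemma below_above (K : {set I}) : ks K -> below K -> above K -> False.
Proof.
move=> hK /existsP[L /andP[hL LK]] /existsP[M /andP[hM KM]].
have := ks_proper_card hK hL LK; have := ks_proper_card hM hK KM.
by have := ks_proper_card hM hL (proper_trans LK KM); lia.
Qed.

Definition movable (K : {set I}) : {set I} :=
  [set v in K | [forall y, (y \notin K) ==> ~~ e (v, y)]].

Lemma movableP (K : {set I}) v : ks K -> v \in K ->
  (v \in movable K) = ks (K :\ v).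
Proof.
move=> /ksP hK vK; rewrite inE vK /=; apply/forallP/ksP => [h x y xy|h y].
  rewrite !inE; have [xv|xv] := eqVneq x v; have [yv|yv] := eqVneq y v => //=.
  - by rewrite xv yv eqxx in xy.
  - by move=> /esym yK; rewrite xv; apply/negbTE/(implyP (h y)); rewrite yK.
  - move=> xK; rewrite xK simple_sym yv; apply/negbTE/(implyP (h x)).
    by rewrite xK.
  - exact: hK.
apply/implyP=> yK; rewrite h ?inE ?eqxx ?(negbTE yK) ?andbF //.
by apply: contraNneq yK => <-.
Qed.

Lemma belowE (K : {set I}) : ks K -> below K = (movable K != set0).
Proof.
move=> hK; apply/existsP/set0Pn => [[L /andP[hL LK]]|[v vm]].
  have /properP[sLK [v vK vL]] := LK; exists v; rewrite movableP //.
  suff -> : K :\ v = L by [].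
  apply/esym/eqP; rewrite eqEcard subsetD1 sLK vL /=.
  by have := ks_proper_card hK hL LK; rewrite (cardsD1 v) vK add1n => -[->].
have vK : v \in K by move: vm; rewrite inE => /andP[].
exists (K :\ v); rewrite -movableP // vm properD1 //.
Qed.
End KS.

(** * Invariance under relabelling *)

Section KSRelabel.
Variables (I J : finType) (s : iso I J) (e : edge_rel I).

Lemma imset_bwdK : cancel (fun K : {set I} => s @: K) (fun L => bwd s @: L).
Proof. by move=> K; rewrite -imset_comp (eq_imset _ (fwdK s)) imset_id. Qed.

Lemma imset_fwdK : cancel (fun L : {set J} => bwd s @: L) (fun K => s @: K).
Proof. by move=> K; rewrite -imset_comp (eq_imset _ (bwdK s)) imset_id. Qed.

Definition set_iso : iso {set I} {set J} := Iso imset_bwdK imset_fwdK.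

Lemma exists_relabel (A B : finType) (t : iso A B) (p : pred B) :
  [exists y, p y] = [exists x, p (t x)].
Proof.
apply/existsP/existsP=> [[y py]|[x px]]; last by exists (t x).
by exists (bwd t y); rewrite bwdK.
Qed.

Lemma imset_isoC (K : {set I}) : s @: (~: K) = ~: (s @: K).
Proof. by apply/setP=> y; rewrite -(bwdK s y) image_in imageC_in. Qed.

Lemma subset_relabel (K L : {set I}) : (s @: K \subset s @: L) = (K \subset L).
Proof.
apply/idP/idP => [|/imsetS]; last exact.
by move/(imsetS (bwd s)); rewrite !imset_bwdK.
Qed.

Lemma proper_relabel (K L : {set I}) : (s @: K \proper s @: L) = (K \proper L).
Proof. by rewrite !properE !subset_relabel. Qed.

Lemma eq_set_relabel (K L : {set I}) : (s @: K == s @: L) = (K == L).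
Proof. exact: (inj_eq (can_inj imset_bwdK)). Qed.

Lemma ks_relabel (K : {set I}) : ks (relabel s e) (s @: K) = ks e K.
Proof. by rewrite /ks -imset_isoC -(KS_partition_relabel s e (K, ~: K)). Qed.

Lemma below_relabel (K : {set I}) : below (relabel s e) (s @: K) = below e K.
Proof.
rewrite /below (exists_relabel set_iso); apply: eq_existsb => L.
by rewrite /= ks_relabel proper_relabel.
Qed.

Lemma above_relabel (K : {set I}) : above (relabel s e) (s @: K) = above e K.
Proof.
rewrite /above (exists_relabel set_iso); apply: eq_existsb => L.
by rewrite /= ks_relabel proper_relabel.
Qed.

Lemma rigid_relabel (K : {set I}) : rigid (relabel s e) (s @: K) = rigid e K.
Proof.
rewrite /rigid (forall_relabel set_iso); apply: eq_forallb => L.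
by rewrite /= ks_relabel eq_set_relabel.
Qed.

Lemma central_relabel (K : {set I}) :
  central (relabel s e) (s @: K) = central e K.
Proof.
rewrite /central !(forall_relabel set_iso); congr (_ && _);
  apply: eq_forallb => L; rewrite /= ks_relabel.
  by rewrite /nested /= !subset_relabel.
rewrite proper_relabel (exists_relabel set_iso); congr (_ ==> _).
by apply: eq_existsb => M; rewrite /= ks_relabel !eq_set_relabel.
Qed.
End KSRelabel.

(** * Split graphs with a chosen clique side *)

(** All species of graphs with a chosen clique side are cut out of this type by invariant
    predicates. *)
Definition sided (I : finType) : finType := ({set I} * edge_rel I)%type.

Definition sided_relabel (I J : finType) (s : iso I J) (c : sided I) : sided J :=
  (s @: c.1, relabel s c.2).

Section SidedSpecies.
Variable P : forall I : finType, pred (sided I).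
Hypothesis P_relabel : forall (I J : finType) (s : iso I J) (c : sided I),
  P (sided_relabel s c) = P c.

Definition sided_str (I : finType) : finType := {c : sided I | P c}.

Lemma sided_transport_subproof (I J : finType) (s : iso I J)
  (u : sided_str I) : P (sided_relabel s (val u)).
Proof. by rewrite P_relabel; exact: valP. Qed.

Definition sided_transport (I J : finType) (s : iso I J) (u : sided_str I) :
    sided_str J := exist (@P J) _ (sided_transport_subproof s u).

Definition sided_species : species.
Proof.
exists sided_str sided_transport.
- move=> I J s t st u; apply: val_inj; rewrite /= /sided_relabel.
  congr (_, _); first exact: eq_imset.
  apply/ffunP=> p; rewrite !ffunE.
  have st' y : bwd s y = bwd t y.
    by rewrite -[LHS](fwdK t) -st bwdK.
  by rewrite !st'.
- move=> I u; apply: val_inj; rewrite /= /sided_relabel [RHS]surjective_pairing.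
  by congr (_, _); [exact: imset_id|apply/ffunP=> -[x y]; rewrite !ffunE].
- move=> I J K t s u; apply: val_inj; rewrite /= /sided_relabel.
  by congr (_, _); [exact: imset_comp|apply/ffunP=> p; rewrite !ffunE].
Defined.
End SidedSpecies.

Lemma sided_species_split (P Q R : forall I : finType, pred (sided I)) hP hQ hR :
  (forall I c, P I c = Q I c || R I c) ->
  (forall I c, Q I c -> R I c -> False) ->
  species_iso (@sided_species P hP)
              (sp_add (@sided_species Q hQ) (@sided_species R hR)).
Proof.
move=> PQR QR.
have Q_P I (u : @sided_species Q hQ I) : P I (val u).
  by rewrite PQR (valP u).
have R_P I (u : @sided_species R hR I) : P I (val u).
  by rewrite PQR (valP u) orbT.
pose phi I (u : sp_add (@sided_species Q hQ) (@sided_species R hR) I) :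
    @sided_species P hP I :=
  match u with
  | inl v => exist (@P I) _ (Q_P I v) | inr v => exist (@P I) _ (R_P I v)
  end.
symmetry; apply: (natural_bij_iso (phi := phi)).
- by move=> I J s [u|u]; apply: val_inj.
- move=> I [u|u] [v|v] /(congr1 val) /= uv.
  + by congr inl; apply: val_inj.
  + by case: (QR I (val u)); [exact: valP|rewrite (uv : val u = val v); exact: valP].
  + by case: (QR I (val u)); [rewrite (uv : val u = val v); exact: valP|exact: valP].
  + by congr inr; apply: val_inj.
- move=> I [c Pc]; have /orP[h|h] : Q I c || R I c by rewrite -PQR.
    by exists (inl (exist (@Q I) c h)); apply: val_inj.
  by exists (inr (exist (@R I) c h)); apply: val_inj.
Qed.

Definition split_side (I : finType) (c : sided I) :=
  simple_graph c.2 && ks c.2 c.1.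
Definition rigid_side (I : finType) (c : sided I) :=
  split_side c && rigid c.2 c.1.
Definition shrinkable_side (I : finType) (c : sided I) :=
  split_side c && below c.2 c.1.
Definition growable_side (I : finType) (c : sided I) :=
  split_side c && above c.2 c.1.
Definition tight_side (I : finType) (c : sided I) :=
  split_side c && ~~ below c.2 c.1.
Definition central_side (I : finType) (c : sided I) :=
  split_side c && central c.2 c.1.
Definition noncentral_side (I : finType) (c : sided I) :=
  split_side c && ~~ central c.2 c.1.
Definition flexible_side (I : finType) (c : sided I) :=
  split_side c && ~~ rigid c.2 c.1.

Section SideRelabel.
Variables (I J : finType) (s : iso I J) (c : sided I).

Lemma split_side_relabel : split_side (sided_relabel s c) = split_side c.
Proof. by rewrite /split_side /= simple_graph_relabel ks_relabel. Qed.

Lemma rigid_side_relabel : rigid_side (sided_relabel s c) = rigid_side c.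
Proof. by rewrite /rigid_side split_side_relabel /= rigid_relabel. Qed.

Lemma flexible_side_relabel : flexible_side (sided_relabel s c) = flexible_side c.
Proof. by rewrite /flexible_side split_side_relabel /= rigid_relabel. Qed.

Lemma shrinkable_side_relabel :
  shrinkable_side (sided_relabel s c) = shrinkable_side c.
Proof. by rewrite /shrinkable_side split_side_relabel /= below_relabel. Qed.

Lemma growable_side_relabel :
  growable_side (sided_relabel s c) = growable_side c.
Proof. by rewrite /growable_side split_side_relabel /= above_relabel. Qed.

Lemma tight_side_relabel : tight_side (sided_relabel s c) = tight_side c.
Proof. by rewrite /tight_side split_side_relabel /= below_relabel. Qed.

Lemma central_side_relabel : central_side (sided_relabel s c) = central_side c.
Proof. by rewrite /central_side split_side_relabel /= central_relabel. Qed.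

Lemma noncentral_side_relabel :
  noncentral_side (sided_relabel s c) = noncentral_side c.
Proof. by rewrite /noncentral_side split_side_relabel /= central_relabel. Qed.
End SideRelabel.

Definition sp_side := sided_species split_side_relabel.
Definition sp_rigid := sided_species rigid_side_relabel.
Definition sp_flexible := sided_species flexible_side_relabel.
Definition sp_shrinkable := sided_species shrinkable_side_relabel.
Definition sp_growable := sided_species growable_side_relabel.
Definition sp_tight := sided_species tight_side_relabel.
Definition sp_central := sided_species central_side_relabel.
Definition sp_noncentral := sided_species noncentral_side_relabel.

Lemma sp_side_rigid : species_iso sp_side (sp_add sp_rigid sp_flexible).
Proof.
apply: sided_species_split => I c; rewrite /rigid_side /flexible_side.
  by rewrite -andb_orr orbN andbT.
by case/andP=> _ ->; rewrite andbF.
Qed.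

Lemma sp_side_tight : species_iso sp_side (sp_add sp_shrinkable sp_tight).
Proof.
apply: sided_species_split => I c; rewrite /shrinkable_side /tight_side.
  by rewrite -andb_orr orbN andbT.
by case/andP=> _ ->; rewrite andbF.
Qed.

Lemma sp_side_central : species_iso sp_side (sp_add sp_central sp_noncentral).
Proof.
apply: sided_species_split => I c; rewrite /central_side /noncentral_side.
  by rewrite -andb_orr orbN andbT.
by case/andP=> _ ->; rewrite andbF.
Qed.

Lemma sp_flexibleE : species_iso sp_flexible (sp_add sp_shrinkable sp_growable).
Proof.
apply: sided_species_split => I c.
  rewrite /flexible_side /shrinkable_side /growable_side -andb_orr.
  case: (boolP (split_side c)) => //= /andP[c_simple hc].
  exact: not_rigid.
case/andP=> /andP[c_simple hc] hb /andP[_ ha].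
exact (below_above c_simple hc hb ha).
Qed.

(** * Complementation *)

Definition compl_graph (I : finType) (e : edge_rel I) : edge_rel I :=
  [ffun p => (p.1 != p.2) && ~~ e p].

Definition compl_side (I : finType) (c : sided I) : sided I :=
  (~: c.1, compl_graph c.2).

Section Complement.
Variable I : finType.
Implicit Types (c : sided I) (K : {set I}) (e : edge_rel I).

Lemma compl_graph_simple e : simple_graph e -> simple_graph (compl_graph e).
Proof.
move=> e_simple; apply/andP; split; apply/forallP=> x.
  by rewrite ffunE eqxx.
by apply/forallP=> y; rewrite !ffunE /= (eq_sym y x) (simple_sym e_simple y x).
Qed.

Lemma compl_graphK e : simple_graph e -> compl_graph (compl_graph e) = e.
Proof.
move=> e_simple; apply/ffunP=> -[x y]; rewrite !ffunE /=.
have [->|xy] /= := eqVneq x y; first by rewrite simple_irr.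
by rewrite negbK.
Qed.

Lemma ks_compl e K : simple_graph e -> ks (compl_graph e) (~: K) = ks e K.
Proof.
move=> e_simple; have e'_simple := compl_graph_simple e_simple.
apply/(ksP e'_simple)/(ksP e_simple) => h x y xy.
  have := h x y xy; rewrite !inE !ffunE /= xy => h' xK.
  by apply/negb_inj/h'; rewrite xK.
rewrite !inE !ffunE /= xy => /negb_inj xK; by rewrite (h x y xy xK).
Qed.

Lemma below_compl e K :
  simple_graph e -> below (compl_graph e) (~: K) = above e K.
Proof.
move=> e_simple; apply/existsP/existsP=> -[L /andP[hL LK]]; exists (~: L).
  by rewrite -ks_compl // setCK hL properCr.
by rewrite ks_compl // hL properC.
Qed.
End Complement.

Lemma sp_growable_shrinkable : species_iso sp_growable sp_shrinkable.
Proof.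
have sub I (u : sp_growable I) : shrinkable_side (compl_side (val u)).
  case: u => c /= /andP[/andP[sc hc] ac].
  rewrite /shrinkable_side /split_side /= compl_graph_simple //.
  by rewrite ks_compl // hc below_compl.
apply: (natural_bij_iso (phi := fun I (u : sp_growable I) =>
    exist (@shrinkable_side I) _ (sub I u) : sp_shrinkable I)).
- move=> I J s u; apply: val_inj; rewrite /= /compl_side /sided_relabel /=.
  rewrite -imset_isoC; congr (_, _); apply/ffunP=> p.
  by rewrite !ffunE /= (inj_eq (can_inj (bwdK s))).
- move=> I [[K e] ue] [[K' e'] ue'] /(congr1 val) /= [/setC_inj KK' ee'].
  apply: val_inj => /=; rewrite KK' -[e]compl_graphK ?ee' ?compl_graphK //.
    by case/andP: ue' => /andP[].
  by case/andP: ue => /andP[].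
- move=> I [[K e] /= h]; have /andP[/andP[/= se he] be] := h.
  have h' : growable_side (compl_side (K, e)).
    rewrite /growable_side /split_side /= compl_graph_simple // ks_compl // he /=.
    by rewrite -below_compl ?compl_graph_simple // setCK compl_graphK.
  exists (exist (@growable_side I) _ h'); apply: val_inj => /=.
  by rewrite /compl_side /= setCK compl_graphK.
Qed.

(** * Forgetting the clique side *)

Lemma split_graphE (I : finType) (e : edge_rel I) :
  split_graph e = simple_graph e && [exists K, ks e K].
Proof.
congr (_ && _); apply/existsP/existsP=> [[[K S]]|[K hK]]; last by exists (K, ~: K).
by rewrite KS_partitionE => /andP[_ hK]; exists K.
Qed.

Lemma balancedE (I : finType) (e : edge_rel I) :
  balanced e = simple_graph e && (#|[set K | ks e K]| == 1).
Proof.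
rewrite /balanced split_graphE -andbA; congr (_ && _).
have -> : [set KS | KS_partition e KS] = (fun K => (K, ~: K)) @: [set K | ks e K].
  apply/setP=> -[K S]; rewrite inE KS_partitionE.
  apply/andP/imsetP => [[/eqP-> hK]|].
    by exists K; rewrite ?inE.
  by case=> L; rewrite inE => hL [-> ->].
rewrite card_imset; last by move=> K L [].
apply/andP/idP => [[]|] // /cards1P[K eK]; rewrite eK cards1; split=> //.
by apply/existsP; exists K; move/setP/(_ K): eK; rewrite !inE eqxx.
Qed.

Lemma balancedP (I : finType) (e : edge_rel I) :
  reflect (exists K, rigid_side (K, e)) (balanced e).
Proof.
rewrite balancedE; apply: (iffP andP) => [[se /cards1P[K eK]]|[K]].
  exists K; rewrite /rigid_side /split_side /= se /=.
  have hK L : ks e L = (L == K) by move/setP/(_ L): eK; rewrite !inE.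
  by rewrite hK eqxx /=; apply/forallP=> L; rewrite hK implybb.
case/andP=> /andP[/= se hK] /forallP rK; split=> //.
apply/cards1P; exists K; apply/setP=> L; rewrite !inE.
by apply/idP/eqP => [hL|-> //]; apply/eqP; have := rK L; rewrite hL.
Qed.

(** A balanced graph carries exactly one rigid side, so [sp_rigid] stands for the balanced split
    graphs. *)
Lemma sp_split_unbalanced :
  species_iso sp_split (sp_add sp_unbalanced sp_rigid).
Proof.
have U_S I (u : sp_unbalanced I) : split_graph (val u).
  by case: u => e /= /andP[].
have R_S I (u : sp_rigid I) : split_graph (val u).2.
  case: u => -[K e] /= /andP[/andP[/= se hK] _].
  by rewrite split_graphE se; apply/existsP; exists K.
pose phi I (u : sp_add sp_unbalanced sp_rigid I) : sp_split I :=
  match u with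
  | inl v => exist (@split_graph I) _ (U_S I v)
  | inr v => exist (@split_graph I) _ (R_S I v)
  end.
have disj I (u : sp_unbalanced I) (v : sp_rigid I) : val u = (val v).2 -> False.
  case: u v => e /= /andP[_ /balancedP nb] [[K e'] /= rK] ee'; apply: nb.
  by exists K; rewrite ee'.
symmetry; apply: (natural_bij_iso (phi := phi)).
- by move=> I J s [u|u]; apply: val_inj.
- move=> I [u|u] [v|v] /(congr1 val) /= uv.
  + by congr inl; apply: val_inj.
  + by case: (disj I u v).
  + by case: (disj I v u).
  + congr inr; apply: val_inj; case: u v uv => -[K e] /= rK [[L e'] /= rL] ee'.
    rewrite -ee' in rL *; congr (_, _).
    case/andP: rK => _ /forallP/(_ L); case/andP: rL => /andP[_ /= ->] _.
    by move/eqP.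
- move=> I [e se]; case: (boolP (balanced e)) => [/balancedP[K rK]|nb].
    by exists (inr (exist (@rigid_side I) (K, e) rK)); apply: val_inj.
  have ue : unbalanced e by rewrite /unbalanced se.
  by exists (inl (exist (@unbalanced I) e ue)); apply: val_inj.
Qed.

Lemma sp_central_split : species_iso sp_central sp_split.
Proof.
have C_S I (u : sp_central I) : split_graph (val u).2.
  case: u => -[K e] /= /andP[/andP[/= se hK] _].
  by rewrite split_graphE se; apply/existsP; exists K.
apply: (natural_bij_iso (phi := fun I (u : sp_central I) =>
    exist (@split_graph I) _ (C_S I u) : sp_split I)).
- by move=> I J s u; apply: val_inj.
- move=> I [[K e] uK] [[L e'] uL] /(congr1 val) /= ee'.
  apply: val_inj => /=; rewrite -ee' in uL *; congr (_, _).
  case/andP: uK => /andP[/= se hK] cK; case/andP: uL => /andP[/= _ hL] cL.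
  exact (central_unique se hK hL cK cL).
- move=> I [e h]; have := h; rewrite split_graphE => /andP[se /existsP[K hK]].
  have [M hM cM] := central_exists se hK.
  have uM : central_side (M, e) by rewrite /central_side /split_side /= se hM.
  by exists (exist (@central_side I) (M, e) uM); apply: val_inj.
Qed.

(** * Adjoining clique vertices without neighbours on the stable side *)

Section Extend.
Variables (I : finType) (V : {set I}).

Definition extend_clique (c : sided (part (~: V))) : {set I} :=
  V :|: val @: c.1.

(** The existential reads edges off [c] without casting labels to [part (~: V)]. It fails as soon as
    one label is in [V], so vertices of [V] get no neighbour on the stable side. *)
Definition extend_graph (c : sided (part (~: V))) : edge_rel I :=
  [ffun p => if (p.1 \in extend_clique c) && (p.2 \in extend_clique c)
             then p.1 != p.2
             else [exists u, exists v,
                    [&& val u == p.1, val v == p.2 & c.2 (u, v)]]].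

Definition extend (c : sided (part (~: V))) : sided I :=
  (extend_clique c, extend_graph c).

Definition restrict (c : sided I) : sided (part (~: V)) :=
  ([set u | val u \in c.1], [ffun p => c.2 (val p.1, val p.2)]).

Lemma partCP x : x \in V \/ exists u : part (~: V), x = val u.
Proof.
case: (boolP (x \in V)) => xV; [by left|right].
by rewrite -in_setC in xV; exists (exist _ x xV).
Qed.

Lemma val_partC (u : part (~: V)) : (val u \in V) = false.
Proof. by apply/negbTE; rewrite -in_setC; apply: valP. Qed.

Lemma extend_cliqueV c x : x \in V -> x \in extend_clique c.
Proof. by rewrite inE => ->. Qed.

Lemma extend_cliqueE c u : (val u \in extend_clique c) = (u \in c.1).
Proof. by rewrite inE val_partC mem_imset //; apply: val_inj. Qed.

Section ExtendSide.
Variable c : sided (part (~: V)).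
Hypothesis c_side : split_side c.

Let c_simple : simple_graph c.2. Proof. by case/andP: c_side. Qed.
Let c_ks : ks c.2 c.1. Proof. by case/andP: c_side. Qed.

Lemma extend_graph_val u v : extend_graph c (val u, val v) = c.2 (u, v).
Proof.
rewrite ffunE /= !extend_cliqueE; case: ifP => [/andP[uK vK]|_].
  rewrite (inj_eq val_inj); have [->|uv] := eqVneq u v; first by rewrite simple_irr.
  by move/(ksP c_simple): c_ks => ->; rewrite ?uK ?vK.
apply/existsP/idP => [[u' /existsP[v' /and3P[/eqP/val_inj-> /eqP/val_inj->]]] //|].
by exists u; apply/existsP; exists v; rewrite !eqxx.
Qed.

Lemma extend_graphV x y : x \in V ->
  extend_graph c (x, y) = (y \in extend_clique c) && (x != y).
Proof.
move=> xV; rewrite ffunE /= extend_cliqueV //=; case: ifP => // _.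
by apply/existsP=> -[u /existsP[v /and3P[/eqP ux _ _]]]; rewrite -ux val_partC in xV.
Qed.

Lemma extend_graphVr x y : y \in V ->
  extend_graph c (x, y) = (x \in extend_clique c) && (x != y).
Proof.
move=> yV; rewrite ffunE /= (extend_cliqueV c yV) andbT; case: ifP => // _.
by apply/existsP=> -[u /existsP[v /and3P[_ /eqP vy _]]]; rewrite -vy val_partC in yV.
Qed.

Lemma restrict_extend : restrict (extend c) = c.
Proof.
rewrite [RHS]surjective_pairing; congr (_, _).
  by apply/setP=> u; rewrite inE extend_cliqueE.
by apply/ffunP=> -[u v]; rewrite ffunE extend_graph_val.
Qed.

Lemma extend_simple : simple_graph (extend_graph c).
Proof.
apply/andP; split; apply/forallP=> x; [|apply/forallP=> y].
  case: (partCP x) => [xV|[u ->]]; last by rewrite extend_graph_val simple_irr.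
  by rewrite extend_graphV // eqxx andbF.
case: (partCP x) => [xV|[u ->]].
  by rewrite (extend_graphV _ xV) (extend_graphVr _ xV) (eq_sym x y).
case: (partCP y) => [yV|[v ->]]; last first.
  by rewrite !extend_graph_val (simple_sym c_simple u v).
by rewrite (extend_graphV _ yV) (extend_graphVr _ yV) (eq_sym y).
Qed.

Lemma extend_ks : ks (extend_graph c) (extend_clique c).
Proof.
apply/(ksP extend_simple) => x y xy.
case: (partCP x) => [xV|[u xu]].
  by rewrite (extend_graphV _ xV) xy andbT.
case: (partCP y) => [yV|[v yv]].
  by rewrite (extend_graphVr _ yV) xy andbT.
rewrite xu yv !extend_cliqueE extend_graph_val => uv.
move/(ksP c_simple): c_ks => -> //.
by apply: contraNneq xy; rewrite xu yv => ->.
Qed.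

Lemma extend_side : split_side (extend c).
Proof. by rewrite /split_side extend_simple extend_ks. Qed.

(** Extending leaves the stable side unchanged, so old vertices keep their status, while vertices of
    [V] have no neighbour there. *)
Lemma extend_movable :
  movable (extend_graph c) (extend_clique c) = V :|: val @: movable c.2 c.1.
Proof.
apply/setP=> x; rewrite [LHS]inE [RHS]inE.
case: (partCP x) => [xV|[u ->]].
  rewrite xV extend_cliqueV //=; apply/forallP=> y; apply/implyP=> yK.
  by rewrite extend_graphV // (negbTE yK).
rewrite val_partC mem_imset; last exact: val_inj.
rewrite extend_cliqueE [RHS]inE; case: (boolP (u \in c.1)) => //= uK.
apply/forallP/forallP=> h y; apply/implyP=> yK.
  by rewrite -extend_graph_val (implyP (h _)) // extend_cliqueE.
case: (partCP y) => [yV|[v yv]]; first by rewrite extend_cliqueV in yK.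
rewrite yv extend_cliqueE in yK *.
by rewrite extend_graph_val (implyP (h v)).
Qed.
End ExtendSide.

Section Restrict.
Variable c : sided I.
Hypothesis c_side : split_side c.
Hypothesis V_movable : V \subset movable c.2 c.1.

Let c_simple : simple_graph c.2. Proof. by case/andP: c_side. Qed.
Let c_ks : ks c.2 c.1. Proof. by case/andP: c_side. Qed.

Let VK x : x \in V -> x \in c.1.
Proof. by move/(subsetP V_movable); rewrite inE => /andP[]. Qed.

Lemma restrict_side : split_side (restrict c).
Proof.
have r_simple : simple_graph (restrict c).2.
  apply/andP; split; apply/forallP=> u; [|apply/forallP=> v]; rewrite !ffunE /=.
    by rewrite simple_irr.
  by rewrite (simple_sym c_simple (val u)).
rewrite /split_side r_simple; apply/(ksP r_simple) => u v uv.
rewrite !inE ffunE /=; apply: (ksP c_simple _ c_ks).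
by rewrite (inj_eq val_inj).
Qed.

(** The neighbours of a movable vertex are exactly the other vertices of the clique side, so
    deleting it loses no information. *)
Lemma extend_restrict : extend (restrict c) = c.
Proof.
have K_eq : extend_clique (restrict c) = c.1.
  apply/setP=> x; case: (partCP x) => [xV|[u ->]].
    by rewrite extend_cliqueV // VK.
  by rewrite extend_cliqueE inE.
rewrite [RHS]surjective_pairing /extend K_eq; congr (_, _).
have out x y : x \in V -> c.2 (x, y) = (y \in c.1) && (x != y).
  move=> xV; have [->|xy] := eqVneq x y; first by rewrite simple_irr ?andbF.
  rewrite andbT; case: (boolP (y \in c.1)) => yK.
    by move/(ksP c_simple): c_ks => ->; rewrite ?(VK xV) ?yK.
  move/(subsetP V_movable): xV; rewrite inE => /andP[_ /forallP/(_ y)].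
  by rewrite yK => /negbTE.
apply/ffunP=> -[x y].
case: (partCP x) => [xV|[u ->]]; first by rewrite extend_graphV // K_eq out.
case: (partCP y) => [yV|[v ->]].
  by rewrite extend_graphVr // K_eq simple_sym // out // eq_sym.
by rewrite extend_graph_val ?restrict_side // ffunE.
Qed.
End Restrict.
End Extend.

Lemma extend_relabel (I J : finType) (s : iso I J) (V : {set I})
    (c : sided (part (~: V))) :
  extend (sided_relabel (iso_res (imageC_in s V)) c) =
  sided_relabel s (extend c).
Proof.
set t := iso_res _.
have K_eq : extend_clique (sided_relabel t c) = s @: extend_clique c.
  by rewrite /extend_clique /= imsetU -!imset_comp.
rewrite /extend /sided_relabel /= K_eq; congr (_, _).
apply/ffunP=> -[x' y']; rewrite -(bwdK s x') -(bwdK s y').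
move: (bwd s x') (bwd s y') => x y; rewrite relabelE !ffunE /= K_eq !image_in.
case: ifP => _; first by rewrite (inj_eq (@iso_inj _ _ s)).
rewrite (exists_relabel t); apply: eq_existsb => u.
rewrite (exists_relabel t); apply: eq_existsb => v.
by rewrite /= !(inj_eq (@iso_inj _ _ s)) -(relabelE t).
Qed.

Lemma card_part (I : finType) (V : {set I}) : #|part V| = #|V|.
Proof. by rewrite card_sig; apply: eq_card => x; rewrite inE. Qed.

Section ExtendSpecies.
Variable P : pred nat.
Variable Q : forall I : finType, pred (sided I).
Hypothesis Q_relabel : forall (I J : finType) (s : iso I J) (c : sided I),
  Q (sided_relabel s c) = Q c.
Hypothesis Q_side : forall (I : finType) (c : sided I), Q c -> split_side c.

Definition extend_str (I : finType)
    (x : sp_mul (card_species P) (sided_species Q_relabel) I) : sided I :=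
  let: existT V (_, u) := x in @extend I V (val u).

Lemma extend_str_natural (I J : finType) (s : iso I J)
    (x : sp_mul (card_species P) (sided_species Q_relabel) I) :
  extend_str (transport s x) = sided_relabel s (extend_str x).
Proof. by case: x => V [p u]; apply: extend_relabel. Qed.

(** The extended graph alone need not determine [V]; each application recovers [V] by its own
    means. *)
Lemma extend_str_inj (I : finType)
    (x y : sp_mul (card_species P) (sided_species Q_relabel) I) :
  projT1 x = projT1 y -> extend_str x = extend_str y -> x = y.
Proof.
case: x y => V [p u] [W [q v]] /= VW; case: W / VW q v => q v uv.
rewrite (card_str_eq p q); suff -> : u = v by [].
apply: val_inj; rewrite -[LHS]restrict_extend; last exact/Q_side/valP.
by rewrite [X in restrict _ X]uv restrict_extend //; apply/Q_side/valP.
Qed.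

Lemma extend_str_side (I : finType)
    (x : sp_mul (card_species P) (sided_species Q_relabel) I) :
  split_side (extend_str x).
Proof. by case: x => V [p u]; apply/extend_side/Q_side/valP. Qed.

Lemma extend_str_onto (I : finType) (V : {set I}) (c : sided I) :
  split_side c -> V \subset movable c.2 c.1 -> P #|V| -> Q (restrict V c) ->
  exists2 x : sp_mul (card_species P) (sided_species Q_relabel) I,
    projT1 x = V & extend_str x = c.
Proof.
move=> hc Vm PV Qc.
have pV : P #|part V| by rewrite card_part.
exists (existT _ V (exist (fun=> P #|part V|) tt pV, exist (@Q _) _ Qc)) => //=.
exact: extend_restrict.
Qed.
End ExtendSpecies.

(** * Removing all movable vertices, and marking one *)

Lemma sp_side_E_tight : species_iso (sp_mul sp_E sp_tight) sp_side.
Proof.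
have tightS I (c : sided I) : tight_side c -> split_side c by case/andP.
(* A tight side has no movable vertex, so the added set is recovered as the movable set of the
   extension. *)
have movableV I (x : sp_mul sp_E sp_tight I) :
    movable (extend_str x).2 (extend_str x).1 = projT1 x.
  case: x => V [p u]; have := valP u => /andP[hu].
  rewrite belowE; [|by case/andP: hu..].
  rewrite negbK /= => /eqP m0; rewrite extend_movable //.
  by rewrite m0 imset0 setU0.
apply: (natural_bij_iso (phi := fun I (x : sp_mul sp_E sp_tight I) =>
    exist (@split_side I) _ (extend_str_side tightS x) : sp_side I)).
- by move=> I J s x; apply: val_inj; apply: extend_str_natural.
- move=> I x y /(congr1 val) /= xy; apply: (extend_str_inj tightS) => //.
  by rewrite -!movableV xy.
- move=> I [c hc]; have /andP[sc kc] := hc.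
  have hr : split_side (restrict (movable c.2 c.1) c) := restrict_side _ hc.
  (* By [extend_movable], a vertex still movable after the removal was movable before, hence was
     removed. *)
  have tc : tight_side (restrict (movable c.2 c.1) c).
    have /andP[sr kr] := hr; rewrite /tight_side hr belowE // negbK -subset0.
    have e := extend_movable hr.
    have ec := extend_restrict hc (subxx _).
    rewrite (congr1 fst ec : extend_clique _ = _) in e.
    rewrite (congr1 snd ec : extend_graph _ = _) in e.
    apply/subsetP=> u um.
    case/negP: (negbT (val_partC u)).
    suff: val u \in movable c.2 c.1 :|: [set val v | v in
        movable (restrict (movable c.2 c.1) c).2 (restrict (movable c.2 c.1) c).1].
      by rewrite -e.
    by apply/setUP; right; apply: imset_f.
  have [x _ ex] :=
    @extend_str_onto predT _ tight_side_relabel _ _ _ hc (subxx _) isT tc.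
  by exists x; apply: val_inj.
Qed.

(** A clique side [K] with a marked movable vertex [v] is the edge of the star joining [K] and
    [K :\ v]; [shrink] returns its non-central end. *)
Lemma sp_X_side : species_iso (sp_mul sp_X sp_side) sp_noncentral.
Proof.
have sideS I (c : sided I) : split_side c -> split_side c by [].
pose shrink I (x : sp_mul sp_X sp_side I) : sided I :=
  let c := extend_str x in
  if central c.2 c.1 then (c.1 :\: projT1 x, c.2) else c.
have small I (x : sp_mul sp_X sp_side I) :
    [/\ projT1 x \subset (extend_str x).1, projT1 x != set0 &
        ks (extend_str x).2 ((extend_str x).1 :\: projT1 x)].
  case: x => V [p u]; have := card_str_pred p; rewrite card_part => /cards1P[v eV].
  have hu : split_side (val u) by exact: valP.
  have vV : v \in V by rewrite eV inE.
  split; rewrite /=.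
  - exact: subsetUl.
  - by apply/set0Pn; exists v.
  - rewrite (congr1 (setD _) eV : _ = _ :\ v) -movableP ?extend_simple ?extend_ks //.
      by rewrite extend_movable // inE vV.
    exact: extend_cliqueV.
have shrink_noncentral I (x : sp_mul sp_X sp_side I) : noncentral_side (shrink I x).
  have [VK V0 hKV] := small I x.
  have /andP[sx kx] := extend_str_side sideS x.
  rewrite /shrink; case: ifP => cx; rewrite /noncentral_side /split_side /= sx.
    rewrite hKV /=; apply/negP=> cKV.
    have e := central_unique sx kx hKV cx cKV.
    case/set0Pn: V0 => v vV; move: (subsetP VK v vV).
    by rewrite e inE vV.
  by rewrite kx cx.
(* The other end is the centre [M], so the larger and smaller ends are the union and the
   intersection of [M] with the image under [shrink]. *)
have other I (x : sp_mul sp_X sp_side I) M : let c := extend_str x in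
    ks c.2 M -> central c.2 M ->
    c.1 = (shrink I x).1 :|: M /\ c.1 :\: projT1 x = (shrink I x).1 :&: M.
  move=> c hM cM; have [VK V0 hKV] := small I x.
  have /andP[sx kx] := extend_str_side sideS x.
  rewrite /shrink; case: ifP => cx /=.
    rewrite (central_unique sx hM kx cM cx); split.
      by apply/esym/setUidPr/subsetDl.
    by apply/esym/setIidPl/subsetDl.
  suff -> : M = c.1 :\: projT1 x.
    split; first by apply/esym/setUidPl/subsetDl.
    by apply/esym/setIidPr/subsetDl.
  (* Otherwise [M] would be a third side, nested with both ends of the edge. *)
  apply/esym/eqP/negPn/negP=> nM.
  have nested_M L : ks c.2 L -> nested M L.
    by move=> hL; case/andP: cM => /forallP/(_ L) + _; rewrite hL.
  have nKV : c.1 != c.1 :\: projT1 x.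
    by apply: contra_neq V0 => /esym/setDidPl; rewrite -setI_eq0 => /eqP <-;
      apply/esym/setIidPr.
  have nKKV : nested c.1 (c.1 :\: projT1 x) by rewrite /nested subsetDl orbT.
  have := no_three_nested sx kx hKV hM nKKV.
  rewrite nested_sym nested_M // nested_sym nested_M // => /(_ isT isT nKV nM).
  by move=> /eqP KM; move: cx; rewrite KM cM.
apply: (natural_bij_iso (phi := fun I (x : sp_mul sp_X sp_side I) =>
    exist (@noncentral_side I) _ (shrink_noncentral I x) : sp_noncentral I)).
- move=> I J s x; apply: val_inj; rewrite /= /shrink extend_str_natural /=.
  rewrite central_relabel; case: ifP => // _.
  case: x => V [p u]; congr (_, _); apply/setP=> y.
  by rewrite -(bwdK s y) image_in /= !in_setD !image_in.
- move=> I x y /(congr1 val) /= xy.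
  have sh2 z : (shrink I z).2 = (extend_str z).2 by rewrite /shrink; case: ifP.
  have e_xy : (extend_str x).2 = (extend_str y).2 by rewrite -!sh2 xy.
  have /andP[sx kx] := extend_str_side sideS x.
  have [M hM cM] := central_exists sx kx.
  have [Kx KVx] := other I x M hM cM.
  move: hM cM; rewrite e_xy => hM cM.
  have [Ky KVy] := other I y M hM cM.
  have V_of (z : sp_mul sp_X sp_side I) :
      projT1 z = (extend_str z).1 :\: ((extend_str z).1 :\: projT1 z).
    by have [VK _ _] := small I z; rewrite setDDr setDv set0U; apply/esym/setIidPr.
  apply: (extend_str_inj sideS).
    by rewrite V_of [RHS]V_of KVx KVy Kx Ky xy.
  by rewrite [LHS]surjective_pairing [RHS]surjective_pairing e_xy Kx Ky xy.
- move=> I [[L e] hLe]; have /andP[/andP[/= se hL] ncL] := hLe.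
  have [M hM cM] := central_exists se hL.
  have nLM : L != M by apply: contraNneq ncL => ->.
  have nestLM : nested L M.
    by case/andP: cM => /forallP/(_ L) + _; rewrite hL nested_sym.
  have onto (K K' : {set I}) : ks e K -> ks e K' -> K' \proper K ->
      exists2 x : sp_mul sp_X sp_side I,
        projT1 x = K :\: K' & extend_str x = (K, e).
    move=> hK hK' K'K; have cK := ks_proper_card se hK hK' K'K.
    have K'_sub := proper_sub K'K.
    have V1 : #|K :\: K'| == 1.
      by rewrite cardsD (setIidPr K'_sub) cK subSnn.
    have hKe : split_side (K, e) by rewrite /split_side /= se hK.
    apply: extend_str_onto => //; last exact: restrict_side.
    apply/subsetP=> v vV; have /cards1P[w ew] := V1.
    have vK : v \in K by move: vV; rewrite inE => /andP[].
    rewrite movableP //= (_ : K :\ v = K') //.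
    have -> : [set v] = K :\: K' by move: vV; rewrite ew inE => /eqP->.
    by rewrite setDDr setDv set0U; apply/setIidPr.
  (* The mark goes on the larger of [L] and [M]: [shrink] removes it again if that is the centre,
     and keeps the side [L] if not. *)
  case/orP: nestLM => [LM|ML].
    have [x Vx ex] : exists2 x : sp_mul sp_X sp_side I,
      projT1 x = M :\: L & extend_str x = (M, e).
      by apply: onto => //; rewrite properEneq nLM.
    exists x; apply: val_inj; rewrite /= /shrink ex /= cM Vx.
    by rewrite setDDr setDv set0U; congr (_, _); apply/setIidPr.
  have [x Vx ex] : exists2 x : sp_mul sp_X sp_side I,
    projT1 x = L :\: M & extend_str x = (L, e).
    by apply: onto => //; rewrite properEneq eq_sym nLM.
  by exists x; apply: val_inj; rewrite /= /shrink ex /= (negbTE ncL).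
Qed.

(** * Solving the equations *)

Lemma sub_eq_of_add (F G H : vspecies) : veq F (vadd G H) -> veq G (vsub F H).
Proof. by move=> FGH; rewrite FGH; ring. Qed.

Theorem theorem2p11 :
  let S := virt sp_split in
  let U := virt sp_unbalanced in
  let E := virt sp_E in
  let X := virt sp_X in
  (U ≡ ((vnat 2 - X) * E - vnat 2) / ((vnat 1 - X) * E) * S)%V.
Proof.
move=> S U E X; rewrite /vdiv.
have nat1 : veq (vnat 1) (virt sp_one) by rewrite /veq /=; ring.
have nat2 : veq (vnat 2) (vadd (virt sp_one) (virt sp_one)).
  by rewrite /veq /=; ring.
set D := (((vnat 1 - X) * E)%V); set N := (((vnat 2 - X) * E - vnat 2)%V).
set C := virt sp_side; set Z := virt sp_tight; set B := virt sp_rigid.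
set M := virt sp_shrinkable.
have CE : veq C (vmul E Z).
  by rewrite -virt_mul; symmetry; apply/virt_iso/sp_side_E_tight.
have CM : veq C (vadd M Z) by rewrite -virt_add; apply/virt_iso/sp_side_tight.
have CB : veq C (vadd B (vadd M M)).
  rewrite -!virt_add; apply: virt_iso.
  by rewrite sp_side_rigid sp_flexibleE sp_growable_shrinkable; reflexivity.
have CS : veq C (vadd S (vmul X C)).
  rewrite -virt_mul -virt_add; apply: virt_iso.
  by rewrite {1}sp_side_central sp_central_split sp_X_side; reflexivity.
have SU : veq S (vadd U B) by rewrite -virt_add; apply/virt_iso/sp_split_unbalanced.
have inv : veq (vmul D (vinv D)) (virt sp_one).
  have [G DG] := one_sub_X_E_invertible.
  by apply: (vmul_vinv (G := G)); rewrite /D nat1.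
have SD : veq S (vmul D Z).
  rewrite (sub_eq_of_add CS) CE /D nat1; ring.
(* With [M = C - Z], the rigid sides are [B = C - 2 M = 2 Z - C], so
   [U = S - B = (2 - X) C - 2 Z]. *)
have UN : veq U (vmul N Z).
  have M_C : veq M (vsub C Z) := sub_eq_of_add CM.
  have B_C : veq B (vsub C (vadd M M)) := sub_eq_of_add CB.
  rewrite (sub_eq_of_add SU) B_C M_C (sub_eq_of_add CS) CE /N nat2; ring.
rewrite UN SD; transitivity (vmul (vmul D (vinv D)) (vmul N Z)); last by ring.
by rewrite inv; ring.
Qed.
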